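(* Let $R'\le R$ be real numbers with $E(e^{2R'X_1})<\infty$ and $E(e^{2RX_1})<\infty$, let $\Pi$ be a finite complex measure on the strip $\{z\in\mathbb{C}: R'\le \Re(z)\le R\}$, and let $H=f(S_N)$ be square-integrable, where $f:(0,\infty)\to\mathbb{R}$ is of the form $f(s)=\int s^z\,\Pi(dz)$. For $z$ in this strip define $$g(z):=\frac{m(z+1)-m(1)m(z)}{m(2)-m(1)^2},\qquad h(z):=m(z)-(m(1)-1)g(z),$$ $$H(z)_n:=h(z)^{N-n}S_n^z,\qquad \xi(z)_n:=g(z)h(z)^{N-n}S_{n-1}^{z-1},\qquad L(z)_n:=H(z)_n-H(z)_0-\sum_{k=1}^n\xi(z)_k\Delta S_k .$$ Then $H$ admits a Föllmer–Schweizer decomposition $H=H_0+\sum_{n=1}^N\xi_n\Delta S_n+L_N$, given by $$H_n=\int H(z)_n\,\Pi(dz),\qquad \xi_n=\int\xi(z)_n\,\Pi(dz),\qquad L_n=\int L(z)_n\,\Pi(dz)=H_n-H_0-\sum_{k=1}^n\xi_k\Delta S_k .$$ Moreover, the processes $H_n$, $\xi_n$ and $L_n$ are real-valued.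
   Context: Let $N$ be a positive integer, $(\Omega,\mathcal{F},(\mathcal{F}_n)_{n\in\{0,1,\dots,N\}},P)$ a filtered probability space and $X=(X_n)_{n=0,\dots,N}$ a real-valued process with stationary independent increments: $X$ is adapted, $X_0=0$, the increments $\Delta X_n:=X_n-X_{n-1}$ ($n=1,\dots,N$) all have the same distribution, and $\Delta X_n$ is independent of $\mathcal{F}_{n-1}$. The discounted stock price is $S_n=S_0\exp(X_n)$ with a constant $S_0>0$, and $\Delta S_n:=S_n-S_{n-1}$. Assume $E(e^{2X_1})<\infty$. Let $m(z):=E(e^{zX_1})$ for all $z\in\mathbb{C}$ with $E(e^{\Re(z)X_1})<\infty$. Assume that $S$ is not deterministic, i.e. $m(2)-m(1)^2\ne0$. For $s>0$, $z\in\mathbb{C}$ we put $s^z=e^{z\log s}$; moreover $0^0=1$. A process $\theta=(\theta_n)_{n=1,\dots,N}$ is predictable if $\theta_n$ is $\mathcal{F}_{n-1}$-measurable for each $n$; $\Theta$ is the set of all real-valued predictable $\theta$ such that $\sum_{k=1}^n\theta_k\Delta S_k$ is square-integrable for $n=1,\dots,N$. Föllmer–Schweizer decomposition: let $S=S_0+M+A$ be the Doob decomposition of $S$ into a martingale $M$ and a predictable process $A$. The sum $H=H_0+\sum_{n=1}^N\xi_n\Delta S_n+L_N$ is called a Föllmer–Schweizer decomposition of $H\in L^2(P)$ if $H_0$ is $\mathcal{F}_0$-measurable, $\xi\in\Theta$, and $L$ is a square-integrable martingale with $L_0=0$ that is orthogonal to $M$ (i.e. $LM$ is a martingale). The notion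 is also used for complex-valued $H,H_0,\xi,L$, in which case $\Re(\xi)\in\Theta$ and $\Im(\xi)\in\Theta$ are required. *)

(* Defs.v *)
From HB Require Import structures.
From mathcomp Require Import all_boot all_order all_algebra.
From mathcomp Require Import all_classical all_reals all_analysis.
From mathcomp Require Export complex.

Set Implicit Arguments.
Unset Strict Implicit.
Unset Printing Implicit Defensive.

Import Order.TTheory GRing.Theory Num.Theory.
Import numFieldNormedType.Exports.

Local Open Scope classical_set_scope.
Local Open Scope ring_scope.
Local Open Scope complex_scope.

(* The Borel sets of the complex plane are the preimages of those of the
   product R * R under z |-> (Re z, Im z). *)
HB.instance Definition _ (R : realType) := isPointed.Build R[i] 0.
HB.instance Definition _ (R : realType) := Measurable.copy R[i]
  (g_sigma_algebra_preimageType (fun z : R[i] => (complex.Re z, complex.Im z))).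

Section complex_measure_parts.
Context d (T : measurableType d) (R : realType).

(* A finite complex measure is a finite, countably additive set function with
   values in R[i], i.e., a charge over the numFieldType R[i]. *)
Definition complex_measure := {charge set T -> \bar R[i]}.

Variable nu : complex_measure.

Definition charge_Re (A : set T) : \bar R := (complex.Re (fine (nu A)))%:E.
Definition charge_Im (A : set T) : \bar R := (complex.Im (fine (nu A)))%:E.

Let charge_part_sigma_additive (phi : {additive R[i] -> R}) :
  (forall z, `|phi z|%:C <= `|z|) ->
  semi_sigma_additive (fun A => (phi (fine (nu A)))%:E).
Proof.
move=> phi_le F mF tF mUF.
have fnu A : measurable A -> nu A = (fine (nu A))%:E.
  by move=> mA; rewrite fineK// fin_num_measure.
have sumE n : (\sum_(0 <= i < n) nu (F i) =
    (\sum_(0 <= i < n) fine (nu (F i)))%:E)%E.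
  rewrite -sumEFin; apply: eq_bigr => i _; exact: fnu.
have /= := @charge_semi_sigma_additive _ _ _ nu F mF tF mUF.
rewrite (fnu _ mUF).
rewrite (_ : (fun n => _) =
  EFin \o (fun n => \sum_(0 <= i < n) fine (nu (F i)))); last exact/funext.
set l := fine (nu (\bigcup_n F n)).
set s := (fun n => \sum_(0 <= i < n) fine (nu (F i))).
move=> nuF.
rewrite (_ : (fun n => _) = EFin \o (phi \o s)); last first.
  by apply: (@boolp.funext nat (\bar R)) => n; rewrite /s /= raddf_sum sumEFin.
suff : (phi \o s @ \oo --> phi l).
  by move=> cvg_s; apply: cvg_EFin => //; exact: nearW.
apply/cvgrPdist_lt => e e0.
have : nbhs l%:E [set x : \bar R[i] | exists2 z, x = z%:E & `|l - z| < e%:C].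
  have : nbhs l (ball l e%:C) by apply: nbhsx_ballx; rewrite ltcR.
  by apply: filterS => z; rewrite -ball_normE => lz; exists z.
move=> /nuF[n _ sn]; exists n => // k /sn[z [<-] lz] /=.
rewrite -raddfB -ltcR; exact: le_lt_trans lz.
Qed.

Let charge_Re0 : charge_Re set0 = 0%E.
Proof. by rewrite /charge_Re charge0. Qed.

Let charge_Im0 : charge_Im set0 = 0%E.
Proof. by rewrite /charge_Im charge0. Qed.

Let charge_Re_finite A : measurable A -> charge_Re A \is a fin_num.
Proof. by []. Qed.

Let charge_Im_finite A : measurable A -> charge_Im A \is a fin_num.
Proof. by []. Qed.

Let charge_Re_sigma_additive : semi_sigma_additive charge_Re.
Proof.
apply: (charge_part_sigma_additive (phi := @complex.Re R)).
exact: normc_ge_Re.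
Qed.

Let charge_Im_sigma_additive : semi_sigma_additive charge_Im.
Proof.
apply: (charge_part_sigma_additive (phi := @complex.Im R)) => z.
by rewrite normc_def lecR -sqrtr_sqr ler_wsqrtr// lerDr sqr_ge0.
Qed.

HB.instance Definition _ := isCharge.Build _ T R charge_Re
  charge_Re0 charge_Re_finite charge_Re_sigma_additive.

HB.instance Definition _ := isCharge.Build _ T R charge_Im
  charge_Im0 charge_Im_finite charge_Im_sigma_additive.

End complex_measure_parts.

Section charge_integral.
Context d (T : measurableType d) (R : realType).
Implicit Types (nu : {charge set T -> \bar R}) (D : set T) (u : T -> R).

Lemma hahn_exists nu :
  exists PN : set T * set T, hahn_decomposition nu PN.1 PN.2.
Proof. by have [A [B AB]] := Hahn_decomposition nu; exists (A, B). Qed.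

(* The positive and negative variations do not depend on the chosen Hahn
   decomposition. *)
Definition charge_pos nu : {finite_measure set T -> \bar R} :=
  jordan_pos (svalP (cid (hahn_exists nu))).
Definition charge_neg nu : {finite_measure set T -> \bar R} :=
  jordan_neg (svalP (cid (hahn_exists nu))).

Definition charge_integrable nu D u :=
  (charge_pos nu).-integrable D (EFin \o u) /\
  (charge_neg nu).-integrable D (EFin \o u).

Definition charge_integral nu D u : R :=
  \int[charge_pos nu]_(x in D) u x - \int[charge_neg nu]_(x in D) u x.

End charge_integral.

Section complex_integral.
Context d (T : measurableType d) (R : realType).
Implicit Types (Pi : complex_measure T R) (D : set T) (u : T -> R[i]).

(* Equivalent to integrability with respect to the total variation of Pi. *)
Definition cintegrable Pi D u :=
  [/\ charge_integrable (charge_Re Pi) D (fun x => complex.Re (u x)),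
      charge_integrable (charge_Re Pi) D (fun x => complex.Im (u x)),
      charge_integrable (charge_Im Pi) D (fun x => complex.Re (u x)) &
      charge_integrable (charge_Im Pi) D (fun x => complex.Im (u x))].

Definition cintegral Pi D u : R[i] :=
  (charge_integral (charge_Re Pi) D (fun x => complex.Re (u x)) -
   charge_integral (charge_Im Pi) D (fun x => complex.Im (u x))) +i*
  (charge_integral (charge_Re Pi) D (fun x => complex.Im (u x)) +
   charge_integral (charge_Im Pi) D (fun x => complex.Re (u x))).

End complex_integral.

Section complex_power.
Context {R : realType}.

Definition cexp (z : R[i]) : R[i] :=
  (expR (complex.Re z))%:C * (cos (complex.Im z) +i* sin (complex.Im z)).

(* s ^ z, only meaningful for 0 < s. *)
Definition cpow (s : R) (z : R[i]) : R[i] := cexp (z * (ln s)%:C).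

Definition strip (a b : R) : set R[i] := [set z | a <= complex.Re z <= b].

End complex_power.

(* Processes are indexed by nat, but only the times 0, ..., N (1, ..., N for
   predictable processes) are meaningful. *)
Section processes.
Context d (T : measurableType d) (R : realType) (P : probability T R).
Variables (N : nat) (F : nat -> set (set T)).
Implicit Types (G : set (set T)) (Y Z : T -> R) (M A S L X theta : nat -> T -> R).

Definition filtration :=
  [/\ forall n, (n <= N)%N -> sigma_algebra setT (F n),
      forall n, (n <= N)%N -> F n `<=` measurable &
      forall m n, (m <= n <= N)%N -> F m `<=` F n].

Definition measurable_wrt G Y := forall B, measurable B -> G (Y @^-1` B).

Definition adapted X := forall n, (n <= N)%N -> measurable_wrt (F n) (X n).

Definition predictable X :=
  forall n, (0 < n <= N)%N -> measurable_wrt (F n.-1) (X n).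

Definition square_integrable Y := Y \in Lfun P 2%:E.

(* Z is a version of the conditional expectation of Y given G. *)
Definition is_cond_exp G Y Z :=
  [/\ Y \in Lfun P 1, Z \in Lfun P 1, measurable_wrt G Z &
      forall B, G B -> \int[P]_(w in B) Z w = \int[P]_(w in B) Y w].

Definition martingale M :=
  [/\ adapted M,
      forall n, (n <= N)%N -> M n \in Lfun P 1 &
      forall m n, (m <= n <= N)%N -> is_cond_exp (F m) (M n) (M m)].

Definition square_integrable_martingale M :=
  martingale M /\ forall n, (n <= N)%N -> square_integrable (M n).

Definition increment X n w : R := X n w - X n.-1 w.

Definition stationary_independent_increments X :=
  [/\ adapted X,
      forall w, X 0%N w = 0,
      forall n B, (0 < n <= N)%N -> measurable B ->
        P (increment X n @^-1` B) = P (increment X 1%N @^-1` B) &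
      forall n E B, (0 < n <= N)%N -> F n.-1 E -> measurable B ->
        P (E `&` increment X n @^-1` B) =
        (P E * P (increment X n @^-1` B))%E].

Definition gains theta S n w : R :=
  \sum_(1 <= k < n.+1) theta k w * increment S k w.

Definition Theta S : set (nat -> T -> R) :=
  [set theta | predictable theta /\
    forall n, (0 < n <= N)%N -> square_integrable (gains theta S n)].

Definition doob_decomposition S M A :=
  [/\ martingale M, predictable A,
      forall w, M 0%N w = 0,
      forall w, A 0%N w = 0 &
      forall n w, (n <= N)%N -> S n w = S 0%N w + M n w + A n w].

Definition orthogonal L M := martingale (fun n w => L n w * M n w).

(* The Doob decomposition is almost surely unique, so the choice of its
   version (M, A) is immaterial. *)
Definition FS_decomposition S (H H0 : T -> R) (xi L : nat -> T -> R) :=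
  [/\ square_integrable H,
      measurable_wrt (F 0%N) H0,
      Theta S xi,
      [/\ square_integrable_martingale L, (forall w, L 0%N w = 0) &
          exists M A, doob_decomposition S M A /\ orthogonal L M] &
      forall w, H w = H0 w + gains xi S N w + L N w].

End processes.

Section model.
Context d (T : measurableType d) (R : realType) (P : probability T R).

Definition cexpectation (Y : T -> R[i]) : R[i] :=
  \int[P]_w complex.Re (Y w) +i* \int[P]_w complex.Im (Y w).

Variables (N : nat) (X : nat -> T -> R) (S0 : R).

Definition exp_moment (a : R) := ('E_P[fun w => expR (a * X 1%N w)] < +oo)%E.

(* m(z) is only meaningful when exp_moment (Re z) holds. *)
Definition mgf (z : R[i]) : R[i] :=
  cexpectation (fun w => cexp (z * (X 1%N w)%:C)).

Definition stock n w : R := S0 * expR (X n w).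

Definition gz (z : R[i]) : R[i] :=
  (mgf (z + 1) - mgf 1 * mgf z) / (mgf 2 - mgf 1 ^+ 2).

Definition hz (z : R[i]) : R[i] := mgf z - (mgf 1 - 1) * gz z.

Definition Hz (z : R[i]) n w : R[i] := hz z ^+ (N - n) * cpow (stock n w) z.

Definition xiz (z : R[i]) n w : R[i] :=
  gz z * hz z ^+ (N - n) * cpow (stock n.-1 w) (z - 1).

Definition Lz (z : R[i]) n w : R[i] :=
  Hz z n w - Hz z 0%N w -
  \sum_(1 <= k < n.+1) xiz z k w * (increment stock k w)%:C.

End model.

(* Main.v *)
Require Import Defs.
From HB Require Import structures.
From mathcomp Require Import all_boot all_order all_algebra.
From mathcomp Require Import all_classical all_reals all_analysis.
From mathcomp Require Import measurable_realfun complex.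
From mathcomp Require Import ring lra.

Set Implicit Arguments.
Unset Strict Implicit.
Unset Printing Implicit Defensive.

Import Order.TTheory GRing.Theory Num.Theory.
Import numFieldNormedType.Exports.

Local Open Scope classical_set_scope.
Local Open Scope ring_scope.
Local Open Scope complex_scope.

(** Write the payoff in the log price: f (expR y) is the integral of
    cexp (z y) over the strip.  The family of functions of y
      value k y = \int h(z)^k cexp (z y) Pi(dz),
      hedge k y = \int g(z) h(z)^k cexp (z y) Pi(dz)
    is a backward recursion in the number k of remaining periods, and the
    decomposition is obtained by regressing value k, period after period, on
    the return of the stock.

    Why the recursion holds: m(z) and m(z + 1) are the expectations of
    cexp (z X_1) and of exp(X_1) cexp (z X_1), so that multiplying the integrand
    by one of them is, by Fubini, averaging the integral over one more step
    ([transform_weighted_mgf]).  With m1 = m(1) and V = m(2) - m(1)^2, this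
    turns the definitions of g and h into
      V hedge k y   = E[exp(X_1) value k (y + X_1)] - m1 E[value k (y + X_1)],
      value k.+1 y  = E[value k (y + X_1)] - (m1 - 1) hedge k y
    ([hedge_regression], [valueS]).  The coefficients of this recursion are
    real and value 0 is the real payoff; hence all these integrals are real
    ([valueE], [hedgeE]), although their integrands are complex.

    Why this gives the decomposition: when the log price moves from y to
    y + X_1, the one-step hedging error is
      step_error = value k (y + X_1) - value k.+1 y - hedge k y (exp(X_1) - 1),
    and the two identities say exactly that it has mean zero and is
    uncorrelated with exp(X_1) - m1 ([integral_step_error],
    [integral_step_error_return]).  The increments of L are such errors, with y
    the log price before the step, and those of the martingale part M of S are
    S_{n-1} (exp(X_n - X_{n-1}) - m1).  Since X_n - X_{n-1} is independent of
    the past and distributed as X_1, the past may be frozen ([joint_law],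
    [freeze_centered]), so L and L M are martingales ([martingale_centered]).

    Square integrability: g and h are bounded on the strip, where
    |cexp (z y)| <= exp(R1 y) + exp(R2 y); so value and hedge are dominated by a
    multiple of this envelope, which is square integrable along the path of the
    log price, and products with a function of the next increment stay square
    integrable by independence ([Lfun2_mul_increment]). *)

(** * Square-integrable random variables *)

Section square_integrable_variables.
Context d (T : measurableType d) (R : realType) (P : probability T R).

Lemma Lfun2P (f : T -> R) : f \in Lfun P 2%:E <->
  measurable_fun setT f /\ (\int[P]_w (f w ^+ 2)%:E < +oo)%E.
Proof.
split=> [f2|[mf f2]].
  split; first by move: f2; rewrite inE => /andP[]; rewrite inE.
  have /integrableP[_] := Lfun2_integrable_sqr f2.
  by under eq_integral do rewrite /= ger0_norm ?sqr_ge0//.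
rewrite inE; apply/andP; split; rewrite inE//=.
rewrite /finite_norm unlock /Lnorm poweR_lty//.
by under eq_integral do rewrite /= powR_mulrn// real_normK ?num_real//.
Qed.

Lemma le_Lfun2 (f g : T -> R) : measurable_fun setT f -> g \in Lfun P 2%:E ->
  (forall w, `|f w| <= g w) -> f \in Lfun P 2%:E.
Proof.
move=> mf /Lfun2P[mg g2] fg; apply/Lfun2P; split=> //.
apply: le_lt_trans g2; apply: ge0_le_integral => //.
- by move=> w _; rewrite lee_fin sqr_ge0.
- by apply/measurable_EFinP; exact: measurable_funX.
- by apply/measurable_EFinP; exact: measurable_funX.
move=> w _; rewrite lee_fin -(@real_normK _ (f w)) ?num_real//.
by rewrite ler_sqr ?nnegrE//; exact: le_trans (fg w).
Qed.

Lemma Lfun2_Lfun1 (f : T -> R) : f \in Lfun P 2%:E -> f \in Lfun P 1.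
Proof.
move=> f2; apply: (Lfun_subset12 (mu := P)) f2.
exact: (@fin_num_measure _ _ _ P _ measurableT).
Qed.

Lemma Lfun2D (f g : T -> R) : f \in Lfun P 2%:E -> g \in Lfun P 2%:E ->
  (fun w => f w + g w) \in Lfun P 2%:E.
Proof. exact: (Lfun_addr_closed P (lee1n 2)).2. Qed.

Lemma Lfun2Z (a : R) (f : T -> R) : f \in Lfun P 2%:E ->
  (fun w => a * f w) \in Lfun P 2%:E.
Proof.
move=> f2; rewrite (_ : (fun w => _) = a \o* f).
  by apply: Lfun_scale f2; rewrite ler1n.
by apply/funext => w; rewrite /= mulrC.
Qed.

Lemma Lfun2_cst (a : R) : (fun=> a) \in Lfun P 2%:E.
Proof. exact: Lfun_cst. Qed.

Lemma Lfun2_measurable (f : T -> R) :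
  f \in Lfun P 2%:E -> measurable_fun setT f.
Proof. by move=> /Lfun2P[]. Qed.

Lemma Lfun2_norm (f : T -> R) : f \in Lfun P 2%:E ->
  (fun w => `|f w|) \in Lfun P 2%:E.
Proof.
move=> /Lfun2P[mf f2]; apply/Lfun2P; split; first exact: measurableT_comp.
by under eq_integral do rewrite real_normK ?num_real//.
Qed.

Lemma Lfun2M_integrable (f g : T -> R) : f \in Lfun P 2%:E ->
  g \in Lfun P 2%:E -> P.-integrable setT (EFin \o (fun w => f w * g w)).
Proof.
by move=> f2 g2; apply/Lfun1_integrable; exact: Lfun2_mul_Lfun1 f2 g2.
Qed.

Lemma Lfun2_integrable (f : T -> R) : f \in Lfun P 2%:E ->
  P.-integrable setT (EFin \o f).
Proof. by move=> f2; apply/Lfun1_integrable; exact: Lfun2_Lfun1. Qed.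

End square_integrable_variables.

(** * Integrals depending on a parameter *)

Section parametric_integrals.
Context d1 d2 (T1 : measurableType d1) (T2 : measurableType d2) (R : realType).

(** The extended-real integral is the difference of the integrals of the
    positive and negative parts, each measurable in x by Tonelli, and [fine] is
    measurable also where this difference is infinite. *)
Lemma measurable_Rintegral_param (mu : {sigma_finite_measure set T2 -> \bar R})
    (D : set T2) (f : T1 * T2 -> R) : measurable D ->
  measurable_fun setT f ->
  measurable_fun setT (fun x => \int[mu]_(y in D) f (x, y)).
Proof.
move=> mD mf.
pose fD : T1 * T2 -> R := fun p => f p * \1_D p.2.
have mfD : measurable_fun setT (EFin \o fD).
  apply/measurable_EFinP; apply: measurable_funM => //.
  exact: measurableT_comp.
apply: (@measurableT_comp _ _ _ _ _ _ fine); first exact: fine_measurable.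
rewrite (_ : (fun x => _) =
  (fubini_F mu ((EFin \o fD)^\+) \- fubini_F mu ((EFin \o fD)^\-))%E).
  apply: emeasurable_funB; apply: measurable_fun_fubini_tonelli_F => //.
  - exact: measurable_funepos.
  - exact: measurable_funeneg.
apply/funext => x; rewrite integral_mkcond integralE /fubini_F.
by congr (_ - _)%E; apply: eq_integral => y _;
  rewrite ?funeposE ?funenegE /fD /= patchE indicE;
  case: (y \in D); rewrite ?mulr1 ?mulr0.
Qed.

(** The domination holds for every x, not only almost every x, so that all the
    inner integrals are finite and real-valued integrals can be exchanged
    without discarding a null set. *)
Lemma Rintegral_fubini (mu : {finite_measure set T1 -> \bar R})
    (nu : {finite_measure set T2 -> \bar R}) (D : set T2) (f : T1 * T2 -> R)
    (c : T1 -> R) :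
  measurable D -> measurable_fun setT f ->
  mu.-integrable setT (EFin \o c) ->
  (forall x y, D y -> `|f (x, y)| <= c x) ->
  \int[nu]_(y in D) \int[mu]_x f (x, y) =
  \int[mu]_x \int[nu]_(y in D) f (x, y).
Proof.
move=> mD mf ic fc.
pose fD : T1 * T2 -> R := fun p => f p * \1_D p.2.
have mfD : measurable_fun setT (EFin \o fD).
  apply/measurable_EFinP; apply: measurable_funM => //.
  exact: measurableT_comp.
have fDc x y : `|fD (x, y)| <= `|c x|.
  rewrite /fD /= indicE normrM; case: (boolP (y \in D)) => [/set_mem Dy|_].
    by rewrite normr1 mulr1; apply: le_trans (ler_norm _); exact: fc.
  by rewrite normr0 mulr0.
have iy x : nu.-integrable setT (fun y => (fD (x, y))%:E).
  apply: (@le_integrable _ _ _ nu setT measurableT _ (fun=> `|c x|%:E)) => //.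
  - exact: (measurable_fun_pair2 (f := EFin \o fD)).
  - by move=> y _; rewrite /= lee_fin normr_id.
  - exact: finite_measure_integrable_cst.
have ix y : mu.-integrable setT (fun x => (fD (x, y))%:E).
  apply: (@le_integrable _ _ _ mu setT measurableT _ (EFin \o c)) => //.
  - exact: (measurable_fun_pair1 (f := EFin \o fD)).
  - by move=> x _; rewrite /= lee_fin.
have iD : (mu \x nu)%E.-integrable setT (EFin \o fD).
  apply/integrable12ltyP => //.
  have [mc cley] := integrableP _ _ _ ic.
  apply: (@le_lt_trans _ _ (\int[mu]_x (`|c x|%:E * nu setT))%E).
    apply: ge0_le_integral => //.
    - by move=> x _; exact: integral_ge0.
    - apply: (measurable_fun_fubini_tonelli_F
        (fun p => `|(EFin \o fD) p|%E)) => //.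
      exact: measurableT_comp.
    - apply: emeasurable_funM => //; apply/measurable_EFinP.
      by apply: measurableT_comp => //; exact/measurable_EFinP.
    - move=> x _; rewrite -integral_cst//; apply: ge0_le_integral => //.
      + apply: measurableT_comp => //.
        exact: (measurable_fun_pair2 (f := EFin \o fD)).
      + by move=> y _ /=; rewrite lee_fin.
  rewrite ge0_integralZr//.
  - apply: lte_mul_pinfty => //; first exact: integral_ge0.
    + by rewrite ge0_fin_numE//; exact: integral_ge0.
    + by rewrite ltey_eq (@fin_num_measure _ _ _ nu).
  - exact: (measurableT_comp (f := abse) _ mc).
have E1 y : D y -> \int[mu]_x f (x, y) = \int[mu]_x fD (x, y).
  move=> Dy; apply: eq_Rintegral => x _.
  by rewrite /fD /= indicE mem_set// mulr1.
have E2 x : \int[nu]_(y in D) f (x, y) = \int[nu]_y fD (x, y).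
  rewrite Rintegral_mkcond; apply: eq_Rintegral => y _.
  by rewrite patchE /fD /= indicE; case: ifP; rewrite ?mulr1 ?mulr0.
under [RHS]eq_Rintegral do rewrite E2.
have -> : \int[nu]_(y in D) \int[mu]_x f (x, y) =
    \int[nu]_y \int[mu]_x fD (x, y).
  rewrite Rintegral_mkcond; apply: eq_Rintegral => y _.
  rewrite patchE; case: (boolP (y \in D)) => [/set_mem/E1//|/negbTE yD].
  under eq_Rintegral do rewrite /fD /= indicE yD mulr0.
  by rewrite Rintegral_cst// mul0r.
rewrite /Rintegral; congr fine.
transitivity (\int[nu]_y (\int[mu]_x (fD (x, y))%:E))%E.
  by apply: eq_integral => y _; rewrite fineK// integrable_fin_num.
rewrite -(Fubini iD); apply: eq_integral => x _.
by rewrite fineK// integrable_fin_num.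
Qed.

End parametric_integrals.

(** * Complex exponentials *)

Section complex_facts.
Context {R : realType}.
Implicit Types a b z : R[i].

Lemma Re_cmul a b : complex.Re (a * b) =
  complex.Re a * complex.Re b - complex.Im a * complex.Im b.
Proof. by case: a; case: b. Qed.

Lemma Im_cmul a b : complex.Im (a * b) =
  complex.Re a * complex.Im b + complex.Im a * complex.Re b.
Proof. by case: a => ? ?; case: b => ? ?. Qed.

Lemma normr_Re_le z (c : R) : `|z| <= c%:C -> `|complex.Re z| <= c.
Proof. by move=> zc; rewrite -lecR; apply: le_trans zc; exact: normc_ge_Re. Qed.

Lemma normr_Im_le z (c : R) : `|z| <= c%:C -> `|complex.Im z| <= c.
Proof.
move=> zc; rewrite -lecR; apply: le_trans zc.
by rewrite normc_def lecR -sqrtr_sqr ler_wsqrtr// lerDr sqr_ge0.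
Qed.

Lemma norm_le_ReIm z (x y : R) :
  `|complex.Re z| <= x -> `|complex.Im z| <= y -> `|z| <= (x + y)%:C.
Proof.
move=> za zb; rewrite normc_def lecR; apply: le_trans (lerD za zb).
rewrite -[leRHS]ger0_norm ?addr_ge0// -sqrtr_sqr ler_wsqrtr//.
by rewrite sqrrD !real_normK ?num_real// lerD2r lerDl mulrn_wge0 ?mulr_ge0.
Qed.

Lemma cexpD a b : cexp (a + b) = cexp a * cexp b.
Proof.
case: a => a1 a2; case: b => b1 b2; rewrite /cexp /= expRD cosD sinD.
by apply/eqP; rewrite eq_complex /=; apply/andP; split; apply/eqP; ring.
Qed.

Lemma cexp_real (x : R) : cexp x%:C = (expR x)%:C.
Proof.
rewrite /cexp /= cos0 sin0.
by apply/eqP; rewrite eq_complex /=; apply/andP; split; apply/eqP; ring.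
Qed.

Lemma norm_cexp z : `|cexp z| = (expR (complex.Re z))%:C.
Proof.
rewrite /cexp normrM normc_def /= normc_def /=.
rewrite cos2Dsin2 sqrtr1 mulr1 expr0n /= addr0 sqrtr_sqr.
by rewrite ger0_norm ?expR_ge0.
Qed.

(** For y of a fixed sign, Re z |-> exp(Re z * y) is monotone, so the maximum
    over the strip is attained on one of its two sides. *)
Lemma norm_cexp_strip (r1 r2 y : R) z : strip r1 r2 z ->
  `|cexp (z * y%:C)| <= (expR (r1 * y) + expR (r2 * y))%:C.
Proof.
rewrite /strip /= => /andP[r1z zr2].
rewrite norm_cexp lecR Re_cmul /= mulr0 subr0.
have [y0|y0] := leP 0 y.
  apply: (@le_trans _ _ (expR (r2 * y))); last by rewrite lerDr expR_ge0.
  by rewrite ler_expR ler_wpM2r.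
apply: (@le_trans _ _ (expR (r1 * y))); last by rewrite lerDl expR_ge0.
by rewrite ler_expR ler_wnM2r// ltW.
Qed.

End complex_facts.

(** * Measurability and integrals of complex functions *)

Section complex_measurability.
Context {R : realType}.

Definition cmeasurable d (T : measurableType d) (u : T -> R[i]) :=
  measurable_fun setT (fun x => complex.Re (u x)) /\
  measurable_fun setT (fun x => complex.Im (u x)).

Lemma cmeasurable_id : cmeasurable (@id R[i]).
Proof.
have mp : measurable_fun setT (fun z : R[i] => (complex.Re z, complex.Im z)).
  move=> _ B mB; exists B => //; exact: setTI.
split.
  exact: (measurableT_comp (measurable_fst) mp).
exact: (measurableT_comp (measurable_snd) mp).
Qed.

Context d (T : measurableType d).
Implicit Types u v : T -> R[i].

Lemma cmeasurable_real (f : T -> R) :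
  measurable_fun setT f -> cmeasurable (fun x => (f x)%:C).
Proof. by move=> mf; split => //=; exact: measurable_cst. Qed.

Lemma cmeasurable_cst (a : R[i]) : cmeasurable (fun _ : T => a).
Proof. by split; exact: measurable_cst. Qed.

Lemma cmeasurableD u v : cmeasurable u -> cmeasurable v ->
  cmeasurable (fun x => u x + v x).
Proof.
move=> [? ?] [? ?]; split.
  by under eq_fun do rewrite raddfD; exact: measurable_funD.
by under eq_fun do rewrite raddfD; exact: measurable_funD.
Qed.

Lemma cmeasurableM u v : cmeasurable u -> cmeasurable v ->
  cmeasurable (fun x => u x * v x).
Proof.
move=> [? ?] [? ?]; split.
  under eq_fun do rewrite Re_cmul.
  by apply: measurable_funB; exact: measurable_funM.
under eq_fun do rewrite Im_cmul.
by apply: measurable_funD; exact: measurable_funM.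
Qed.

Lemma cmeasurable_cexp u : cmeasurable u -> cmeasurable (fun x => cexp (u x)).
Proof.
move=> [mRe mIm]; rewrite /cexp; apply: cmeasurableM.
  by apply: cmeasurable_real; exact: measurableT_comp.
by split => /=; apply: measurableT_comp => //;
  apply: continuous_measurable_fun => x;
  [exact: continuous_cos|exact: continuous_sin].
Qed.

End complex_measurability.

Lemma cmeasurable_comp {R : realType} d d' (T : measurableType d)
    (T' : measurableType d') (u : T' -> R[i]) (g : T -> T') :
  cmeasurable u -> measurable_fun setT g -> cmeasurable (u \o g).
Proof.
by move=> [mRe mIm] mg; split; [exact: (measurableT_comp mRe mg)|
  exact: (measurableT_comp mIm mg)].
Qed.

Lemma measurable_strip (R : realType) (r1 r2 : R) : measurable (strip r1 r2).
Proof.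
have [mRe _] := @cmeasurable_id R.
have := mRe measurableT _ (measurable_itv `[r1, r2]).
rewrite setTI; congr (measurable _); apply/seteqP; split=> z /=;
  by rewrite in_itv.
Qed.

Section positive_measures.
Context d (T : measurableType d) (R : realType).
Variables (mu : {measure set T -> \bar R}) (D : set T).
Hypothesis mD : measurable D.
Implicit Types u v : T -> R[i].

(** On setT and for a probability this is [cexpectation]. *)
Definition cint u : R[i] :=
  (\int[mu]_(x in D) complex.Re (u x)) +i* (\int[mu]_(x in D) complex.Im (u x)).

Definition cint_integrable u :=
  mu.-integrable D (EFin \o (fun x => complex.Re (u x))) /\
  mu.-integrable D (EFin \o (fun x => complex.Im (u x))).

Lemma eq_cint u v : (forall x, D x -> u x = v x) -> cint u = cint v.
Proof.
move=> uv; congr (_ +i* _); apply: eq_Rintegral => x /set_mem Dx; by rewrite uv.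
Qed.

Let integrableDR (f g : T -> R) : mu.-integrable D (EFin \o f) ->
  mu.-integrable D (EFin \o g) ->
  mu.-integrable D (EFin \o (fun x => f x + g x)).
Proof. exact: integrableD. Qed.

Let integrableZR (c : R) (f : T -> R) : mu.-integrable D (EFin \o f) ->
  mu.-integrable D (EFin \o (fun x => c * f x)).
Proof. exact: integrableZl. Qed.

Lemma cint_integrableD u v : cint_integrable u -> cint_integrable v ->
  cint_integrable (fun x => u x + v x).
Proof.
move=> [u1 u2] [v1 v2]; split.
  by under eq_fun do rewrite raddfD; exact: integrableDR.
by under eq_fun do rewrite raddfD; exact: integrableDR.
Qed.

Lemma cint_integrableZ a u : cint_integrable u ->
  cint_integrable (fun x => a * u x).
Proof.
move=> [u1 u2]; split.
  under eq_fun do rewrite Re_cmul -mulNr.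
  by apply: integrableDR; exact: integrableZR.
under eq_fun do rewrite Im_cmul.
by apply: integrableDR; exact: integrableZR.
Qed.

Lemma cintD u v : cint_integrable u -> cint_integrable v ->
  cint (fun x => u x + v x) = cint u + cint v.
Proof.
move=> [u1 u2] [v1 v2]; apply/eqP; rewrite eq_complex /=; apply/andP; split.
  by rewrite -RintegralD//; under eq_Rintegral do rewrite raddfD.
by rewrite -RintegralD//; under eq_Rintegral do rewrite raddfD.
Qed.

Lemma cintZ a u : cint_integrable u -> cint (fun x => a * u x) = a * cint u.
Proof.
move=> [u1 u2]; apply/eqP; rewrite eq_complex Re_cmul Im_cmul /=.
apply/andP; split.
  rewrite -!RintegralZl// -RintegralB//; try exact: integrableZR.
  by under eq_Rintegral do rewrite Re_cmul.
rewrite -!RintegralZl// -RintegralD//; try exact: integrableZR.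
by under eq_Rintegral do rewrite Im_cmul.
Qed.

End positive_measures.

Section finite_measures.
Context d (T : measurableType d) (R : realType).
Variables (mu : {finite_measure set T -> \bar R}) (D : set T).
Hypothesis mD : measurable D.
Implicit Types u : T -> R[i].

Lemma cint_integrable_bounded u (c : R) : cmeasurable u ->
  (forall z, D z -> `|u z| <= c%:C) -> cint_integrable mu D u.
Proof.
move=> [mRe mIm] uc.
have ic : mu.-integrable D (fun=> c%:E) by exact: finite_measure_integrable_cst.
split; apply: (le_integrable mD _ _ ic).
- by apply/measurable_EFinP; exact: measurable_funTS.
- move=> z Dz; rewrite /= lee_fin; apply: le_trans (ler_norm c).
  by apply: normr_Re_le; exact: uc.
- by apply/measurable_EFinP; exact: measurable_funTS.
- move=> z Dz; rewrite /= lee_fin; apply: le_trans (ler_norm c).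
  by apply: normr_Im_le; exact: uc.
Qed.

Lemma Rintegral_bounded_le (g : T -> R) (c : R) : measurable_fun setT g ->
  (forall z, D z -> `|g z| <= c) -> `|\int[mu]_(x in D) g x| <= c * fine (mu D).
Proof.
move=> mg gc.
have ic : mu.-integrable D (fun=> c%:E) by exact: finite_measure_integrable_cst.
have ig : mu.-integrable D (EFin \o g).
  apply: (le_integrable mD _ _ ic).
    by apply/measurable_EFinP; exact: measurable_funTS.
  by move=> z Dz; rewrite /= lee_fin; apply: le_trans (ler_norm c); exact: gc.
apply: le_trans (le_normr_Rintegral mD ig) _.
rewrite -Rintegral_cst//; apply: le_Rintegral => //.
exact: integrable_norm.
Qed.

End finite_measures.

Section complex_measures.
Context d (T : measurableType d) (R : realType).
Variables (Pi : complex_measure T R) (D : set T).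
Hypothesis mD : measurable D.
Implicit Types u v : T -> R[i].

(** Every property of [cintegral] is inherited from the four positive measures
    that make up a complex measure. *)
Lemma cintegralE u : cintegral Pi D u =
  cint (charge_pos (charge_Re Pi)) D u - cint (charge_neg (charge_Re Pi)) D u +
  'i * (cint (charge_pos (charge_Im Pi)) D u
        - cint (charge_neg (charge_Im Pi)) D u).
Proof.
apply/eqP; rewrite eq_complex /cintegral /charge_integral /cint /=.
by apply/andP; split; apply/eqP; ring.
Qed.

Lemma cintegrableE u : cintegrable Pi D u <->
  [/\ cint_integrable (charge_pos (charge_Re Pi)) D u,
      cint_integrable (charge_neg (charge_Re Pi)) D u,
      cint_integrable (charge_pos (charge_Im Pi)) D u &
      cint_integrable (charge_neg (charge_Im Pi)) D u].
Proof.
split=> [[[? ?] [? ?] [? ?] [? ?]]|[[? ?] [? ?] [? ?] [? ?]]]; by split; split.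
Qed.

Lemma eq_cintegral u v : (forall x, D x -> u x = v x) ->
  cintegral Pi D u = cintegral Pi D v.
Proof. by move=> uv; rewrite !cintegralE !(eq_cint _ uv). Qed.

Lemma cintegrableD u v : cintegrable Pi D u -> cintegrable Pi D v ->
  cintegrable Pi D (fun x => u x + v x).
Proof.
move=> /cintegrableE[? ? ? ?] /cintegrableE[? ? ? ?].
by apply/cintegrableE; split; exact: cint_integrableD.
Qed.

Lemma cintegrableZ a u : cintegrable Pi D u ->
  cintegrable Pi D (fun x => a * u x).
Proof.
move=> /cintegrableE[? ? ? ?].
by apply/cintegrableE; split; exact: cint_integrableZ.
Qed.

Lemma cintegralD u v : cintegrable Pi D u -> cintegrable Pi D v ->
  cintegral Pi D (fun x => u x + v x) = cintegral Pi D u + cintegral Pi D v.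
Proof.
move=> /cintegrableE[? ? ? ?] /cintegrableE[? ? ? ?].
by rewrite !cintegralE !cintD//; ring.
Qed.

Lemma cintegralZ a u : cintegrable Pi D u ->
  cintegral Pi D (fun x => a * u x) = a * cintegral Pi D u.
Proof.
by move=> /cintegrableE[? ? ? ?]; rewrite !cintegralE !cintZ//; ring.
Qed.

Lemma cintegrable_bounded u (c : R) : cmeasurable u ->
  (forall z, D z -> `|u z| <= c%:C) -> cintegrable Pi D u.
Proof.
by move=> mu uc; apply/cintegrableE; split; exact: cint_integrable_bounded uc.
Qed.

(** That k does not depend on u is what makes the bound on transforms uniform
    in the log price. *)
Lemma cintegral_bounded : exists2 k : R, 0 <= k &
  forall u c, cmeasurable u -> (forall z, D z -> `|u z| <= c%:C) ->
    `|complex.Re (cintegral Pi D u)| <= c * k.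
Proof.
pose m (mu : {finite_measure set T -> \bar R}) := fine (mu D).
exists (m (charge_pos (charge_Re Pi)) + m (charge_neg (charge_Re Pi)) +
  (m (charge_pos (charge_Im Pi)) + m (charge_neg (charge_Im Pi)))).
  by rewrite !addr_ge0// fine_ge0.
move=> u c [mRe mIm] uc; rewrite /cintegral /charge_integral /=.
rewrite !mulrDr; apply: le_trans (ler_normB _ _) _; apply: lerD;
  apply: le_trans (ler_normB _ _) _; apply: lerD;
  apply: Rintegral_bounded_le => // z Dz; do ?[apply: normr_Re_le];
  do ?[apply: normr_Im_le]; exact: uc.
Qed.

Lemma cmeasurable_cintegral d' (T' : measurableType d') (k : T' * T -> R[i]) :
  cmeasurable k -> cmeasurable (fun x => cintegral Pi D (fun z => k (x, z))).
Proof.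
move=> [mRe mIm].
have mI (mu : {finite_measure set T -> \bar R}) (g : T' * T -> R) :
    measurable_fun setT g ->
    measurable_fun setT (fun x => \int[mu]_(z in D) g (x, z)).
  exact: measurable_Rintegral_param.
split => /=; [apply: measurable_funB|apply: measurable_funD];
  by apply: measurable_funB; do ?[exact: (mI _ _ mRe)|exact: (mI _ _ mIm)].
Qed.

End complex_measures.

(** * Exchanging an expectation and a complex integral *)

Section complex_fubini.
Context d1 d2 (T1 : measurableType d1) (T2 : measurableType d2) (R : realType).
Variables (mu : {finite_measure set T1 -> \bar R}) (D : set T2).
Hypothesis mD : measurable D.
Variables (k : T1 * T2 -> R[i]) (c : T1 -> R).
Hypotheses (mk : cmeasurable k) (ic : mu.-integrable setT (EFin \o c)).
Hypothesis kc : forall x z, D z -> `|k (x, z)| <= (c x)%:C.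

Let cint_fubini (nu : {finite_measure set T2 -> \bar R}) :
  cint nu D (fun z => cint mu setT (fun x => k (x, z))) =
  cint mu setT (fun x => cint nu D (fun z => k (x, z))).
Proof.
have [mRe mIm] := mk.
congr (_ +i* _); rewrite /cint /=.
  rewrite (Rintegral_fubini (c := c) nu mD mRe)// => x z Dz /=.
  by apply: normr_Re_le; exact: kc.
rewrite (Rintegral_fubini (c := c) nu mD mIm)// => x z Dz /=.
by apply: normr_Im_le; exact: kc.
Qed.

Let integrable_cint (nu : {finite_measure set T2 -> \bar R}) :
  cint_integrable mu setT (fun x => cint nu D (fun z => k (x, z))).
Proof.
have [mRe mIm] := mk.
have icn : mu.-integrable setT (EFin \o (fun x => fine (nu D) * c x)).
  exact: (integrableZl measurableT (fine (nu D)) ic).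
split; apply: (le_integrable measurableT _ _ icn).
- apply/measurable_EFinP => /=.
  exact: (measurable_Rintegral_param (f := fun p => complex.Re (k p)) nu mD mRe).
- move=> x _; rewrite /= lee_fin; apply: le_trans (ler_norm _).
  rewrite [leRHS]mulrC /cint /=; apply: Rintegral_bounded_le => //.
    exact: (measurableT_comp mRe (pair1_measurable x)).
  by move=> z Dz; apply: normr_Re_le; exact: kc.
- apply/measurable_EFinP => /=.
  exact: (measurable_Rintegral_param (f := fun p => complex.Im (k p)) nu mD mIm).
- move=> x _; rewrite /= lee_fin; apply: le_trans (ler_norm _).
  rewrite [leRHS]mulrC /cint /=; apply: Rintegral_bounded_le => //.
    exact: (measurableT_comp mIm (pair1_measurable x)).
  by move=> z Dz; apply: normr_Im_le; exact: kc.
Qed.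

Lemma cintegral_fubini (Pi : complex_measure T2 R) :
  cintegral Pi D (fun z => cint mu setT (fun x => k (x, z))) =
  cint mu setT (fun x => cintegral Pi D (fun z => k (x, z))).
Proof.
rewrite cintegralE !cint_fubini.
under [in RHS]eq_fun do
  rewrite cintegralE -mulN1r -(mulN1r (cint (charge_neg (charge_Im Pi)) _ _)).
have iN nu := cint_integrableZ measurableT (-1) (integrable_cint nu).
have iB nu1 nu2 := cint_integrableD measurableT (integrable_cint nu1) (iN nu2).
have iZ nu1 nu2 := cint_integrableZ measurableT 'i (iB nu1 nu2).
by rewrite cintD// cintD// (cintZ measurableT 'i)// cintD// !cintZ// !mulN1r.
Qed.

End complex_fubini.

(** * Bounded functions on the strip and their transforms *)

Section bounded_functions.
Context d (T : measurableType d) (R : realType) (D : set T).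
Implicit Types u v : T -> R[i].

Definition cbounded u :=
  cmeasurable u /\ exists c : R, forall z, D z -> `|u z| <= c%:C.

Lemma cbounded_cst (a : R[i]) : cbounded (fun=> a).
Proof.
split; first exact: cmeasurable_cst.
exists (Num.sqrt (complex.Re a ^+ 2 + complex.Im a ^+ 2)) => z _.
by rewrite normc_def.
Qed.

Lemma cboundedD u v : cbounded u -> cbounded v -> cbounded (fun z => u z + v z).
Proof.
move=> [mu [c uc]] [mv [e ve]]; split; first exact: cmeasurableD.
exists (c + e) => z Dz; rewrite rmorphD; apply: le_trans (ler_normD _ _) _.
by apply: lerD; [exact: uc|exact: ve].
Qed.

Lemma cboundedM u v : cbounded u -> cbounded v -> cbounded (fun z => u z * v z).
Proof.
move=> [mu [c uc]] [mv [e ve]]; split; first exact: cmeasurableM.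
exists (c * e) => z Dz; rewrite rmorphM normrM.
by apply: ler_pM => //; [exact: uc|exact: ve].
Qed.

Lemma cboundedX u n : cbounded u -> cbounded (fun z => u z ^+ n).
Proof.
move=> bu; elim: n => [|n IHn]; first exact: (cbounded_cst 1).
rewrite (_ : (fun x => _) = fun x => u x * u x ^+ n); first exact: cboundedM.
by apply/funext => x; rewrite exprS.
Qed.

Lemma cbounded_integrable (mD : measurable D) (Pi : complex_measure T R) u :
  cbounded u -> cintegrable Pi D u.
Proof. by move=> [mu [c uc]]; exact: cintegrable_bounded uc. Qed.

End bounded_functions.

Section transform.
Context (R : realType) (r1 r2 : R) (Pi : complex_measure R[i] R).
Local Notation D := (strip r1 r2).
Implicit Types u v : R[i] -> R[i].

Definition envelope (y : R) : R := expR (r1 * y) + expR (r2 * y).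

(** A Laplace-Fourier transform of the measure u * Pi in the log price y; for
    u = 1 it is the payoff. *)
Definition transform u (y : R) : R[i] :=
  cintegral Pi D (fun z => u z * cexp (z * y%:C)).

Let mD : measurable D. Proof. exact: measurable_strip. Qed.

Lemma cbounded_cexp (y : R) : cbounded D (fun z => cexp (z * y%:C)).
Proof.
split; last by exists (envelope y) => z; exact: norm_cexp_strip.
apply: cmeasurable_cexp; apply: cmeasurableM; first exact: cmeasurable_id.
exact: cmeasurable_cst.
Qed.

Lemma transform_integrable u y : cbounded D u ->
  cintegrable Pi D (fun z => u z * cexp (z * y%:C)).
Proof.
by move=> bu; apply: cbounded_integrable => //; apply: cboundedM => //;
  exact: cbounded_cexp.
Qed.

Lemma transformD u v y : cbounded D u -> cbounded D v ->
  transform (fun z => u z + v z) y = transform u y + transform v y.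
Proof.
move=> bu bv; rewrite -cintegralD//; try exact: transform_integrable.
by apply: eq_cintegral => z _; rewrite mulrDl.
Qed.

Lemma transformZ a u y : cbounded D u ->
  transform (fun z => a * u z) y = a * transform u y.
Proof.
move=> bu; rewrite -cintegralZ//; last exact: transform_integrable.
by apply: eq_cintegral => z _; rewrite mulrA.
Qed.

Let cmeasurable_kernel u : cmeasurable u ->
  cmeasurable (fun p : R * R[i] => u p.2 * cexp (p.2 * p.1%:C)).
Proof.
move=> mu; apply: cmeasurableM.
  exact: (cmeasurable_comp mu (@measurable_snd _ _ _ _)).
apply: cmeasurable_cexp; apply: cmeasurableM.
  exact: (cmeasurable_comp (@cmeasurable_id R) (@measurable_snd _ _ _ _)).
exact: cmeasurable_real.
Qed.

Lemma measurable_transform u : cbounded D u -> cmeasurable (transform u).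
Proof.
by move=> [mu _]; exact: (cmeasurable_cintegral Pi mD (cmeasurable_kernel mu)).
Qed.

Lemma transform_le u : cbounded D u ->
  exists2 c : R, 0 <= c &
    forall y, `|complex.Re (transform u y)| <= c * envelope y.
Proof.
move=> bu; have [mu [c uc]] := bu.
have [k k0 kP] := cintegral_bounded Pi mD.
exists (`|c| * k); first exact: mulr_ge0.
move=> y; rewrite mulrAC; apply: kP.
  exact: (cboundedM bu (cbounded_cexp y)).1.
move=> z Dz; rewrite normrM rmorphM; apply: ler_pM => //.
  apply: le_trans (uc z Dz) _; rewrite lecR; exact: ler_norm.
exact: norm_cexp_strip.
Qed.

Context d (T : measurableType d) (P : probability T R) (ret : T -> R).
Hypothesis mret : measurable_fun setT ret.
Hypothesis env2 : (fun w => envelope (ret w)) \in Lfun P 2%:E.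

(** The product envelope y * envelope x is envelope (y + x) plus positive cross
    terms. *)
Lemma envelope_shift y : (fun w => envelope (y + ret w)) \in Lfun P 2%:E.
Proof.
have menv : measurable_fun setT (fun w => envelope (y + ret w)).
  apply: measurable_funD; apply: measurableT_comp => //;
  by apply: measurable_funM => //; apply: measurable_funD.
apply: (le_Lfun2 menv (Lfun2Z (envelope y) env2)) => w.
rewrite /envelope ger0_norm ?addr_ge0 ?expR_ge0//.
rewrite (mulrDr r1) (mulrDr r2) !expRD.
rewrite (mulrDl _ _ (_ + _)); apply: lerD.
  by rewrite ler_wpM2l ?expR_ge0// lerDl expR_ge0.
by rewrite ler_wpM2l ?expR_ge0// lerDr expR_ge0.
Qed.

(** For r = 1 and r = exp(X_1) these are m(z) and m(z + 1). *)
Definition weighted_mgf (r : T -> R) (z : R[i]) : R[i] :=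
  cexpectation P (fun w => (r w)%:C * cexp (z * (ret w)%:C)).

Let cmeasurable_weighted (r : T -> R) : measurable_fun setT r ->
  cmeasurable (fun p : R[i] * T => (r p.2)%:C * cexp (p.1 * (ret p.2)%:C)).
Proof.
move=> mr; apply: cmeasurableM.
  by apply: cmeasurable_real; exact: measurableT_comp.
apply: cmeasurable_cexp; apply: cmeasurableM.
  exact: (cmeasurable_comp (@cmeasurable_id R) (@measurable_fst _ _ _ _)).
by apply: cmeasurable_real; exact: measurableT_comp.
Qed.

Let weighted_le (r : T -> R) z w : D z ->
  `|(r w)%:C * cexp (z * (ret w)%:C)| <= (`|r w| * envelope (ret w))%:C.
Proof.
move=> Dz; rewrite normrM rmorphM; apply: ler_pM => //.
  by rewrite normc_def /= expr0n addr0 sqrtr_sqr.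
exact: norm_cexp_strip.
Qed.

Let weighted_integrable (r : T -> R) z : r \in Lfun P 2%:E -> D z ->
  cint_integrable P setT (fun w => (r w)%:C * cexp (z * (ret w)%:C)).
Proof.
move=> lr Dz.
have [mRe mIm] := cmeasurable_weighted (Lfun2_measurable lr).
have ic := Lfun2M_integrable (Lfun2_norm lr) env2.
split; apply: (le_integrable measurableT _ _ ic).
- by apply/measurable_EFinP; exact: (measurableT_comp mRe (pair1_measurable z)).
- move=> w _; rewrite /= lee_fin; apply: le_trans (ler_norm _).
  exact: (normr_Re_le (weighted_le r w Dz)).
- by apply/measurable_EFinP; exact: (measurableT_comp mIm (pair1_measurable z)).
- move=> w _; rewrite /= lee_fin; apply: le_trans (ler_norm _).
  exact: (normr_Im_le (weighted_le r w Dz)).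
Qed.

(** On the strip the integrand is at most |r| * envelope, which is integrable
    as a product of two square-integrable variables. *)
Lemma cbounded_weighted_mgf (r : T -> R) : r \in Lfun P 2%:E ->
  cbounded D (weighted_mgf r).
Proof.
move=> lr.
have mr := Lfun2_measurable lr.
have [mRe mIm] := cmeasurable_weighted mr.
have ic := Lfun2M_integrable (Lfun2_norm lr) env2.
split.
  split => /=.
    exact: (measurable_Rintegral_param P measurableT mRe).
  exact: (measurable_Rintegral_param P measurableT mIm).
pose e := \int[P]_w (`|r w| * envelope (ret w)).
have le_e (g : T -> R) : measurable_fun setT g ->
    (forall w, `|g w| <= `|r w| * envelope (ret w)) -> `|\int[P]_w g w| <= e.
  move=> mg ge.
  have ig : P.-integrable setT (EFin \o g).
    apply: (le_integrable measurableT _ _ ic); first exact/measurable_EFinP.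
    by move=> w _; rewrite /= lee_fin; apply: le_trans (ler_norm _).
  apply: le_trans (le_normr_Rintegral measurableT ig) _.
  by apply: le_Rintegral => //; exact: integrable_norm.
exists (e + e) => z Dz; apply: norm_le_ReIm; apply: le_e.
- exact: (measurableT_comp mRe (pair1_measurable z)).
- by move=> w; exact: (normr_Re_le (weighted_le r w Dz)).
- exact: (measurableT_comp mIm (pair1_measurable z)).
- by move=> w; exact: (normr_Im_le (weighted_le r w Dz)).
Qed.

(** Multiplying the integrand by a moment generating function averages the
    transform over one step of the log price: cexp (z y) times cexp (z X_1) is
    cexp (z (y + X_1)), and the rest is Fubini. *)
Lemma transform_weighted_mgf u (r : T -> R) y :
  cbounded D u -> r \in Lfun P 2%:E ->
  transform (fun z => u z * weighted_mgf r z) y =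
  cexpectation P (fun w => (r w)%:C * transform u (y + ret w)).
Proof.
move=> bu lr; have [mu [c uc]] := bu.
have mr := Lfun2_measurable lr.
pose k (p : T * R[i]) :=
  (r p.1)%:C * (u p.2 * cexp (p.2 * (y + ret p.1)%:C)).
have mk : cmeasurable k.
  apply: cmeasurableM.
    by apply: cmeasurable_real; exact: measurableT_comp.
  apply: (cmeasurable_comp
    (u := fun p : R * R[i] => u p.2 * cexp (p.2 * p.1%:C))
    (g := fun p : T * R[i] => (y + ret p.1, p.2))).
    exact: cmeasurable_kernel.
  apply: measurable_fun_pair => //; apply: measurable_funD => //.
  exact: measurableT_comp.
pose b w := `|c| * (`|r w| * envelope (y + ret w)).
have ib : P.-integrable setT (EFin \o b).
  exact: (integrableZl measurableT `|c|
    (Lfun2M_integrable (Lfun2_norm lr) (envelope_shift y))).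
have kb w z : D z -> `|k (w, z)| <= (b w)%:C.
  move=> Dz; rewrite /k /b /= normrM (normrM (u z)) !rmorphM /= mulrCA.
  apply: ler_pM => //; try exact: mulr_ge0.
  - apply: le_trans (uc z Dz) _; rewrite lecR; exact: ler_norm.
  apply: ler_pM => //; last exact: norm_cexp_strip.
  by rewrite normc_def /= expr0n addr0 sqrtr_sqr.
transitivity (cintegral Pi D (fun z => cint P setT (fun w => k (w, z)))).
  apply: eq_cintegral => z Dz.
  rewrite mulrAC -cintZ//; last exact: weighted_integrable.
  apply: eq_cint => w _; rewrite /k /= rmorphD mulrDr cexpD /=; ring.
rewrite (cintegral_fubini (mu := P) mD mk ib kb); apply: eq_cint => w _.
by rewrite -cintegralZ//; exact: transform_integrable.
Qed.

End transform.

(** * The backward recursion of values and hedges *)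

Section one_period.
Context (R : realType) d (T : measurableType d) (P : probability T R).
Context (X : nat -> T -> R) (r1 r2 : R) (Pi : complex_measure R[i] R).
Context (f : R -> R).
Hypothesis mX : measurable_fun setT (X 1%N).
Hypothesis exp2 : (fun w => expR (X 1%N w)) \in Lfun P 2%:E.
Hypothesis env2 : (fun w => envelope r1 r2 (X 1%N w)) \in Lfun P 2%:E.
Hypothesis nondeterministic : mgf P X 2 - mgf P X 1 ^+ 2 != 0.
Hypothesis payoff : forall s, 0 < s ->
  (f s)%:C = cintegral Pi (strip r1 r2) (cpow s).

Local Notation ret := (X 1%N).
Local Notation D := (strip r1 r2).
Local Notation trans := (transform r1 r2 Pi).
Local Notation wmgf := (weighted_mgf P ret).

Definition mean_return : R := \int[P]_w expR (ret w).
Definition var_return : R := \int[P]_w expR (ret w) ^+ 2 - mean_return ^+ 2.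
Local Notation m1 := mean_return.
Local Notation V := var_return.

Lemma mgf_weighted z : mgf P X z = wmgf (fun=> 1) z.
Proof. by apply: eq_cint => w _; rewrite mul1r. Qed.

Lemma mgf_weighted1 z : mgf P X (z + 1) = wmgf (fun w => expR (ret w)) z.
Proof.
by apply: eq_cint => w _; rewrite mulrDl mul1r cexpD cexp_real mulrC.
Qed.

Lemma mgf1E : mgf P X 1 = m1%:C.
Proof.
rewrite /mgf (_ : cexpectation P _ =
  cexpectation P (fun w => (expR (ret w))%:C)).
  rewrite /cexpectation /=; congr (_ +i* _).
  by rewrite Rintegral_cst// mul0r.
by apply: eq_cint => w _; rewrite mul1r cexp_real.
Qed.

Lemma mgf2E : mgf P X 2 = (\int[P]_w expR (ret w) ^+ 2)%:C.
Proof.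
rewrite /mgf (_ : cexpectation P _ =
  cexpectation P (fun w => (expR (ret w) ^+ 2)%:C)).
  rewrite /cexpectation /=; congr (_ +i* _).
  by rewrite Rintegral_cst// mul0r.
apply: eq_cint => w _.
by rewrite mulrDl mul1r cexpD cexp_real expr2 rmorphM.
Qed.

Lemma var_returnE : mgf P X 2 - mgf P X 1 ^+ 2 = V%:C.
Proof. by rewrite mgf2E mgf1E rmorphB rmorphXn. Qed.

Lemma var_return_neq0 : V != 0.
Proof.
by move: nondeterministic; rewrite var_returnE; apply: contra_neq => ->.
Qed.

Lemma gzE z : gz P X z =
  (V^-1)%:C * (wmgf (fun w => expR (ret w)) z + (- m1)%:C * wmgf (fun=> 1) z).
Proof.
rewrite /gz var_returnE mgf_weighted1 mgf1E mgf_weighted mulrC fmorphV.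
by rewrite rmorphN mulNr.
Qed.

Lemma hzE z : hz P X z = wmgf (fun=> 1) z + (- (m1 - 1))%:C * gz P X z.
Proof. by rewrite /hz mgf1E mgf_weighted rmorphN rmorphB mulNr. Qed.

Lemma cbounded_gz : cbounded D (gz P X).
Proof.
have -> := funext gzE.
apply: cboundedM; first exact: cbounded_cst.
apply: cboundedD; first exact: cbounded_weighted_mgf.
apply: cboundedM; first exact: cbounded_cst.
by apply: cbounded_weighted_mgf => //; exact: Lfun2_cst.
Qed.

Lemma cbounded_hz : cbounded D (hz P X).
Proof.
have -> := funext hzE.
apply: cboundedD.
  by apply: cbounded_weighted_mgf => //; exact: Lfun2_cst.
by apply: cboundedM; [exact: cbounded_cst|exact: cbounded_gz].
Qed.

Lemma cbounded_hzX k : cbounded D (fun z => hz P X z ^+ k).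
Proof. exact: cboundedX cbounded_hz. Qed.

Lemma cbounded_gzhzX k : cbounded D (fun z => gz P X z * hz P X z ^+ k).
Proof. by apply: cboundedM; [exact: cbounded_gz|exact: cbounded_hzX]. Qed.

Definition value k y : R := complex.Re (trans (fun z => hz P X z ^+ k) y).

Definition hedge k y : R :=
  complex.Re (trans (fun z => gz P X z * hz P X z ^+ k) y).

(** A real weight r preserves the reality of a transform. *)
Lemma real_transform_weighted (u : R[i] -> R[i]) (r : T -> R) y :
  cbounded D u -> r \in Lfun P 2%:E -> (forall x, complex.Im (trans u x) = 0) ->
  trans (fun z => u z * wmgf r z) y =
  (\int[P]_w (r w * complex.Re (trans u (y + ret w))))%:C.
Proof.
move=> bu lr u0; rewrite transform_weighted_mgf// /cexpectation.
congr (_ +i* _).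
  by apply: eq_Rintegral => w _; rewrite Re_cmul /= mul0r subr0.
transitivity (\int[P]_w (0 : R)); last by rewrite Rintegral_cst// mul0r.
by apply: eq_Rintegral => w _; rewrite Im_cmul u0 /= mul0r mulr0 addr0.
Qed.

(** The reality of the k-th transform is an assumption in the next two lemmas
    because it is itself proved by induction from the second one. *)
Let hedge_step k y :
  (forall x, complex.Im (trans (fun z => hz P X z ^+ k) x) = 0) ->
  trans (fun z => gz P X z * hz P X z ^+ k) y =
  (V^-1 * (\int[P]_w (expR (ret w) * value k (y + ret w)) -
           m1 * \int[P]_w value k (y + ret w)))%:C.
Proof.
move=> real_k.
have bk := cbounded_hzX k.
have l1 := Lfun2_cst P 1.
rewrite (_ : (fun z => gz P X z * hz P X z ^+ k) = fun z => (V^-1)%:C *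
   (hz P X z ^+ k * wmgf (fun w => expR (ret w)) z +
   (- m1)%:C * (hz P X z ^+ k * wmgf (fun=> 1) z))); last first.
  by apply/funext => z; rewrite gzE; ring.
have b1 := cboundedM bk (cbounded_weighted_mgf mX env2 exp2).
have b2 := cboundedM bk (cbounded_weighted_mgf mX env2 l1).
have b3 := cboundedM (cbounded_cst D (- m1)%:C) b2.
rewrite transformZ; last exact: cboundedD.
rewrite transformD// transformZ// !real_transform_weighted//.
rewrite -rmorphM -rmorphD -rmorphM mulNr; congr ((_ * (_ - _ * _))%:C).
by apply: eq_Rintegral => w _; rewrite mul1r.
Qed.

Let value_step k y :
  (forall x, complex.Im (trans (fun z => hz P X z ^+ k) x) = 0) ->
  trans (fun z => hz P X z ^+ k.+1) y =
  (\int[P]_w value k (y + ret w) - (m1 - 1) * hedge k y)%:C.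
Proof.
move=> real_k.
have bk := cbounded_hzX k.
have l1 := Lfun2_cst P 1.
rewrite (_ : (fun z => hz P X z ^+ k.+1) = fun z =>
   hz P X z ^+ k * wmgf (fun=> 1) z +
   (- (m1 - 1))%:C * (gz P X z * hz P X z ^+ k)); last first.
  by apply/funext => z; rewrite exprSr {2}hzE; ring.
have b1 := cboundedM bk (cbounded_weighted_mgf mX env2 l1).
have b2 := cbounded_gzhzX k.
have b3 := cboundedM (cbounded_cst D (- (m1 - 1))%:C) b2.
rewrite transformD// transformZ// real_transform_weighted//.
rewrite /hedge hedge_step//= -rmorphM -rmorphD mulNr; congr ((_ - _)%:C).
by apply: eq_Rintegral => w _; rewrite mul1r.
Qed.

(** Reality propagates backward from the payoff: one step of the recursion has
    real coefficients. *)
Lemma valueE k y : trans (fun z => hz P X z ^+ k) y = (value k y)%:C.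
Proof.
suff im0 : forall x, complex.Im (trans (fun z => hz P X z ^+ k) x) = 0.
  rewrite [LHS](_ : _ = complex.Re (trans (fun z => hz P X z ^+ k) y) +i*
    complex.Im (trans (fun z => hz P X z ^+ k) y)); last by case: trans.
  by rewrite im0.
elim: k => [|k IHk] x; last by rewrite value_step.
rewrite (_ : trans _ x = (f (expR x))%:C)// payoff ?expR_gt0//.
by apply: eq_cintegral => z _; rewrite expr0 mul1r /cpow expRK.
Qed.

Let value_real k y : complex.Im (trans (fun z => hz P X z ^+ k) y) = 0.
Proof. by rewrite valueE. Qed.

Lemma hedgeE k y :
  trans (fun z => gz P X z * hz P X z ^+ k) y = (hedge k y)%:C.
Proof. by rewrite /hedge hedge_step. Qed.

Lemma value0 y : value 0 y = f (expR y).
Proof.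
rewrite /value (_ : trans _ y = (f (expR y))%:C)// payoff ?expR_gt0//.
by apply: eq_cintegral => z _; rewrite expr0 mul1r /cpow expRK.
Qed.

Lemma valueS k y :
  value k.+1 y = \int[P]_w value k (y + ret w) - (m1 - 1) * hedge k y.
Proof. by rewrite {1}/value value_step. Qed.

(** [hedge k y] is the slope of the linear regression of [value k (y + X_1)] on
    exp(X_1). *)
Lemma hedge_regression k y :
  V * hedge k y = \int[P]_w (expR (ret w) * value k (y + ret w)) -
                  m1 * \int[P]_w value k (y + ret w).
Proof.
rewrite /hedge hedge_step; last exact: value_real.
by rewrite /= mulrA divff ?mul1r ?var_return_neq0.
Qed.

Lemma measurable_value k : measurable_fun setT (value k).
Proof. by have [] := measurable_transform Pi (cbounded_hzX k). Qed.

Lemma measurable_hedge k : measurable_fun setT (hedge k).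
Proof. by have [] := measurable_transform Pi (cbounded_gzhzX k). Qed.

Lemma value_le k :
  exists2 c : R, 0 <= c & forall y, `|value k y| <= c * envelope r1 r2 y.
Proof. exact: transform_le (cbounded_hzX k). Qed.

Lemma hedge_le k :
  exists2 c : R, 0 <= c & forall y, `|hedge k y| <= c * envelope r1 r2 y.
Proof. exact: transform_le (cbounded_gzhzX k). Qed.

End one_period.

(** * Freezing the past *)

Section freezing.
Context d (T : measurableType d) (R : realType) (P : probability T R).
Variables (G : set (set T)) (Z W : T -> R).
Hypotheses (sG : sigma_algebra setT G) (GT : G `<=` measurable).
Hypotheses (mZ : measurable_fun setT Z) (mW : measurable_fun setT W).
Hypothesis ZW : forall B, measurable B -> P (Z @^-1` B) = P (W @^-1` B).
Hypothesis indepZ : forall E B, G E -> measurable B ->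
  P (E `&` Z @^-1` B) = (P E * P (Z @^-1` B))%E.

Local Notation TG := (g_sigma_algebraType G).

(** Measurability with respect to G is measurability on the type T equipped
    with G, which makes the closure properties of measurable functions
    available for adapted processes. *)
Lemma measurable_genE (A : set TG) : measurable A = G A.
Proof. by rewrite -[RHS](congr1 (fun H => H A) (sigma_algebra_id sG)). Qed.

Lemma measurable_wrtP (Y : T -> R) :
  measurable_wrt G Y <-> measurable_fun setT (Y : TG -> R).
Proof.
split=> [mY _ B mB|mY B mB].
  by rewrite setTI measurable_genE; exact: mY.
by have := mY measurableT B mB; rewrite setTI measurable_genE.
Qed.

Let idG : T -> TG := id.

Lemma measurable_idG : measurable_fun setT idG.
Proof.
by move=> _ B; rewrite measurable_genE setTI => /GT.
Qed.

Let mfid := @isMeasurableFun.Build _ _ _ _ _ measurable_idG.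
Let rvid : {mfun T >-> TG} := HB.pack idG mfid.
Let mfW := @isMeasurableFun.Build _ _ _ _ _ mW.
Let rvW : {mfun T >-> R} := HB.pack W mfW.
Let pairG (w : T) : TG * R := (idG w, Z w).
Lemma measurable_pairG : measurable_fun setT pairG.
Proof. exact: measurable_fun_pair measurable_idG mZ. Qed.
Let mfpair := @isMeasurableFun.Build _ _ _ _ _ measurable_pairG.
Let rvpair : {mfun T >-> (TG * R)%type} := HB.pack pairG mfpair.

(** Independence of G and Z, together with equality in law of Z and W, means
    that w |-> (w, Z w) sends P to a product measure: P on G times the law of
    W. *)
Lemma joint_law (A : set (TG * R)) : measurable A ->
  (distribution P rvid \x distribution P rvW)%E A = distribution P rvpair A.
Proof.
apply: product_measure_unique => E B mE mB.
have GE : G E by rewrite -measurable_genE.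
by have := indepZ GE mB; rewrite ZW.
Qed.

Lemma freeze_ge0 (phi : TG * R -> \bar R) : measurable_fun setT phi ->
  (forall p, 0 <= phi p)%E ->
  (\int[P]_w phi (w, Z w) = \int[P]_w \int[P]_w' phi (w, W w'))%E.
Proof.
move=> mphi phi0.
transitivity (\int[distribution P rvpair]_p phi p)%E.
  by rewrite ge0_integral_distribution.
transitivity (\int[(distribution P rvid \x distribution P rvW)]_p phi p)%E.
  by apply: eq_measure_integral => A mA _; exact: (esym (joint_law mA)).
rewrite fubini_tonelli1// ge0_integral_distribution//.
- apply: eq_integral => w _ /=; rewrite /fubini_F ge0_integral_distribution//.
  exact: (measurableT_comp mphi (pair1_measurable _)).
- exact: measurable_fun_fubini_tonelli_F.
- by move=> w; exact: integral_ge0.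
Qed.

(** If every section phi (w, _) has mean zero under the law of W, then so has
    phi (w, Z w): the conditional expectation given G is computed with w
    frozen. *)
Lemma freeze_centered (phi : TG * R -> R) : measurable_fun setT phi ->
  P.-integrable setT (fun w => (phi (w, Z w))%:E) ->
  (forall w, \int[P]_w' phi (w, W w') = 0) ->
  (forall w, P.-integrable setT (fun w' => (phi (w, W w'))%:E)) ->
  \int[P]_w phi (w, Z w) = 0.
Proof.
move=> mphi iphi phi0 iphi0; rewrite /Rintegral.
have mephi : measurable_fun setT (EFin \o phi) by exact/measurable_EFinP.
transitivity (fine (\int[distribution P rvpair]_p (phi p)%:E)%E).
  by rewrite integral_distribution.
transitivity (fine
    (\int[(distribution P rvid \x distribution P rvW)]_p (phi p)%:E)%E).
  congr fine; apply: eq_measure_integral => A mA _.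
  exact: (esym (joint_law mA)).
have ipair : (distribution P rvid \x distribution P rvW)%E.-integrable setT
    (EFin \o phi).
  apply/integrableP; split=> //.
  rewrite (eq_measure_integral (distribution P rvpair)); last first.
    by move=> A mA _; exact: joint_law.
  rewrite ge0_integral_distribution//; last exact: measurableT_comp.
  by case/integrableP : iphi.
rewrite -(integral12_prod_meas1 ipair).
rewrite (eq_integral (cst 0%E)) ?integral0// => w _.
rewrite /fubini_F integral_distribution//=.
- rewrite -[LHS]fineK; first by congr EFin; exact: phi0.
  exact: integrable_fin_num.
- exact: (measurableT_comp mephi (pair1_measurable _)).
- exact: iphi0.
Qed.

End freezing.

(** * Processes driven by independent increments *)

Section independent_increments.
Context (R : realType) d (T : measurableType d) (P : probability T R).
Context (N : nat) (F : nat -> set (set T)) (X : nat -> T -> R).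
Hypothesis filtF : filtration N F.
Hypothesis siX : stationary_independent_increments P N F X.
Hypothesis N0 : (0 < N)%N.

Local Notation TF n := (g_sigma_algebraType (F n)).
Local Notation inc := (increment X).

Let sF n : (n <= N)%N -> sigma_algebra setT (F n).
Proof. by case: filtF => + _ _; exact. Qed.

Let FT n : (n <= N)%N -> F n `<=` measurable.
Proof. by case: filtF => _ + _; exact. Qed.

Let Fmono m n : (m <= n <= N)%N -> F m `<=` F n.
Proof. by case: filtF => _ _; exact. Qed.

Let X0 w : X 0%N w = 0. Proof. by case: siX. Qed.

Lemma measurable_past n (Y : T -> R) : (n <= N)%N ->
  measurable_fun setT (Y : TF n -> R) -> measurable_fun setT Y.
Proof.
move=> nN mY _ B mB; rewrite setTI; apply: (FT nN).
by move: B mB; exact/(measurable_wrtP (sF nN)).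
Qed.

Lemma measurable_future m n (Y : T -> R) : (m <= n <= N)%N ->
  measurable_fun setT (Y : TF m -> R) -> measurable_fun setT (Y : TF n -> R).
Proof.
move=> /andP[mn nN] mY; apply/(measurable_wrtP (sF nN)) => B mB.
apply: (Fmono (m := m)); first by rewrite mn.
by move: B mB; exact/(measurable_wrtP (sF (leq_trans mn nN))).
Qed.

Lemma measurable_X m n : (m <= n <= N)%N ->
  measurable_fun setT (X m : TF n -> R).
Proof.
move=> /[dup] mnN /andP[mn nN]; apply: (measurable_future mnN).
apply/(measurable_wrtP (sF (leq_trans mn nN))).
by case: siX => + _ _ _; apply; exact: leq_trans nN.
Qed.

Let mX n : (n <= N)%N -> measurable_fun setT (X n).
Proof.
by move=> nN; apply: (measurable_past nN); apply: measurable_X; rewrite leqnn.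
Qed.

Let minc n : (n <= N)%N -> measurable_fun setT (inc n).
Proof.
move=> nN; apply: measurable_funB; first exact: mX.
by apply: mX; exact: leq_trans (leq_pred n) nN.
Qed.

Let inc1 : inc 1 = X 1.
Proof. by apply/funext => w; rewrite /increment X0 subr0. Qed.

Let incE n w : (0 < n)%N -> X n w = X n.-1 w + inc n w.
Proof. by rewrite /increment addrC subrK. Qed.

Section one_step.
Variable n : nat.
Hypothesis nN : (0 < n <= N)%N.

Let nN1 : (n.-1 <= N)%N.
Proof. by case/andP: nN => _; exact: leq_trans (leq_pred n). Qed.

Let mincn : measurable_fun setT (inc n).
Proof. by apply: minc; case/andP: nN. Qed.

Let law_inc B : measurable B -> P (inc n @^-1` B) = P (X 1 @^-1` B).
Proof. by move=> mB; rewrite -inc1; case: siX => _ _ + _; exact. Qed.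

Let indep_inc E B : F n.-1 E -> measurable B ->
  P (E `&` inc n @^-1` B) = (P E * P (inc n @^-1` B))%E.
Proof. by move=> FE mB; case: siX => _ _ _; exact. Qed.

Lemma freeze_increment_ge0 (phi : TF n.-1 * R -> \bar R) :
  measurable_fun setT phi -> (forall p, 0 <= phi p)%E ->
  (\int[P]_w phi (w, inc n w) = \int[P]_w \int[P]_w' phi (w, X 1%N w'))%E.
Proof.
exact: (freeze_ge0 (sF nN1) (FT nN1) mincn (mX N0) law_inc indep_inc).
Qed.

Lemma freeze_increment_centered (phi : TF n.-1 * R -> R) :
  measurable_fun setT phi ->
  P.-integrable setT (fun w => (phi (w, inc n w))%:E) ->
  (forall w, \int[P]_w' phi (w, X 1%N w') = 0) ->
  (forall w, P.-integrable setT (fun w' => (phi (w, X 1%N w'))%:E)) ->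
  \int[P]_w phi (w, inc n w) = 0.
Proof.
exact: (freeze_centered (sF nN1) (FT nN1) mincn (mX N0) law_inc indep_inc).
Qed.

(** E[U^2 v(inc n)^2] = E[U^2] E[v(X_1)^2], by independence. *)
Lemma Lfun2_mul_increment (U : T -> R) (v : R -> R) :
  measurable_fun setT (U : TF n.-1 -> R) -> U \in Lfun P 2%:E ->
  measurable_fun setT v -> (fun w => v (X 1%N w)) \in Lfun P 2%:E ->
  (fun w => U w * v (inc n w)) \in Lfun P 2%:E.
Proof.
move=> mU U2 mv v2; apply/Lfun2P; split.
  apply: measurable_funM; first exact: (Lfun2_measurable U2).
  exact: measurableT_comp.
pose phi (p : TF n.-1 * R) := ((U p.1 * v p.2) ^+ 2)%:E.
rewrite [ltLHS](freeze_increment_ge0 (phi := phi)); last 2 first.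
- apply/measurable_EFinP; apply: measurable_funX; apply: measurable_funM.
    exact: (measurableT_comp mU (@measurable_fst _ _ _ _)).
  exact: (measurableT_comp mv (@measurable_snd _ _ _ _)).
- by move=> p; rewrite lee_fin sqr_ge0.
have [_ iU] := (Lfun2P _ _).1 U2.
have [_ iv] := (Lfun2P _ _).1 v2.
have mU2 := measurable_funX 2 (Lfun2_measurable U2).
have mv2 := measurable_funX 2 (Lfun2_measurable v2).
under eq_integral => w _.
  rewrite /phi /=; under eq_integral do rewrite exprMn EFinM.
  rewrite ge0_integralZl//; last 3 first.
  - exact/measurable_EFinP.
  - by move=> ? _; rewrite lee_fin sqr_ge0.
  - by rewrite lee_fin sqr_ge0.
  over.
rewrite ge0_integralZr//; last 3 first.
- exact/measurable_EFinP.
- by move=> ? _; rewrite lee_fin sqr_ge0.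
- by apply: integral_ge0 => ? _; rewrite lee_fin sqr_ge0.
apply: lte_mul_pinfty => //.
  by apply: integral_ge0 => ? _; rewrite lee_fin sqr_ge0.
by rewrite ge0_fin_numE//; apply: integral_ge0 => ? _; rewrite lee_fin sqr_ge0.
Qed.

End one_step.

(** E[exp(2 a X_n)] = E[exp(2 a X_1)]^n. *)
Lemma Lfun2_expR (a : R) n : (n <= N)%N ->
  (fun w => expR (a * X 1%N w)) \in Lfun P 2%:E ->
  (fun w => expR (a * X n w)) \in Lfun P 2%:E.
Proof.
move=> + a2; elim: n => [_|n IHn nN].
  under eq_fun do rewrite X0 mulr0; exact: Lfun2_cst.
under eq_fun do rewrite incE// mulrDr expRD.
apply: (@Lfun2_mul_increment n.+1 nN _ (fun x => expR (a * x))) => //.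
- apply: measurableT_comp => //; apply: measurable_funM => //.
  by apply: measurable_X; rewrite leqnn /= ltnW.
- by apply: IHn; exact: ltnW.
by apply: measurableT_comp => //; apply: measurable_funM.
Qed.

(** All martingales of the proof have increments phi (w, inc n w) with phi
    measurable in the past and centered in the increment. *)
Lemma martingale_centered (M : nat -> T -> R) :
  (forall n, (n <= N)%N -> measurable_fun setT (M n : TF n -> R)) ->
  (forall n, (n <= N)%N -> M n \in Lfun P 1) ->
  (forall n, (0 < n <= N)%N -> exists phi : TF n.-1 * R -> R,
    [/\ measurable_fun setT phi,
        forall w, M n w = M n.-1 w + phi (w, inc n w),
        forall w, P.-integrable setT (fun w' => (phi (w, X 1%N w'))%:E) &
        forall w, \int[P]_w' phi (w, X 1%N w') = 0]) ->
  martingale P N F M.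
Proof.
move=> adM iM incM; split=> //.
  by move=> n nN; apply/(measurable_wrtP (sF nN)); exact: adM.
move=> m n /andP[mn nN]; have mN := leq_trans mn nN.
split; [exact: iM|exact: iM| |].
  by apply/(measurable_wrtP (sF mN)); exact: adM.
move=> B FB; have mB : measurable B by exact: FT FB.
have iB k : (k <= N)%N -> P.-integrable B (EFin \o M k).
  move=> kN; apply: (@integrableS _ _ _ _ setT) => //.
  by apply/Lfun1_integrable; exact: iM.
elim: n mn nN => [|n IHn]; first by rewrite leqn0 => /eqP ->.
rewrite leq_eqVlt => /predU1P[->//|]; rewrite ltnS => mn nN.
rewrite IHn//; last exact: ltnW.
have [phi [mphi Mphi iphi phi0]] := incM n.+1 nN.
apply/esym/eqP; rewrite -subr_eq0 -RintegralB//; [|exact: iB|exact/iB/ltnW].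
rewrite Rintegral_mkcond; apply/eqP.
have FnB : F n B by apply: (Fmono (m := m)) FB; rewrite mn ltnW.
pose psi (p : TF n * R) := \1_B p.1 * phi p.
rewrite (_ : (fun w => _) = fun w => psi (w, inc n.+1 w)); last first.
  (* integrating over B is integrating the increment times the indicator of B *)
  apply/funext => w; rewrite /psi patchE indicE /= Mphi/=.
  by case: ifP => _; rewrite ?mul1r ?mul0r// addrAC subrr add0r.
have m1B : measurable_fun setT (\1_B : TF n -> R).
  by apply: measurable_indic; rewrite measurable_genE//; exact/sF/ltnW.
apply: (@freeze_increment_centered n.+1) => //.
- apply: measurable_funM => //.
  exact: (measurableT_comp m1B (@measurable_fst _ _ _ _)).
- have := integrableB measurableT ((Lfun1_integrable _ _).1 (iM _ nN))
    ((Lfun1_integrable _ _).1 (iM n (ltnW nN))).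
  move/(fun h => @integrableS _ _ _ P setT B _ measurableT mB (@subsetT _ _) h).
  move/(integrable_mkcond _ mB); apply: eq_integrable => // w _.
  rewrite /psi patchE indicE /= Mphi/=.
  case: ifP => _; rewrite ?mul1r ?mul0r//=.
  by rewrite -EFinB addrAC subrr add0r.
- move=> w; rewrite /psi /= RintegralZl ?phi0 ?mulr0//; exact: iphi.
- move=> w; exact: (integrableZl measurableT (\1_B w) (iphi w)).
Qed.

End independent_increments.

(** * The hedging error and its orthogonality to the stock *)

Section backward_recursion.
Context (R : realType) d (T : measurableType d) (P : probability T R).
Context (N : nat) (F : nat -> set (set T)) (X : nat -> T -> R) (S0 r1 r2 : R).
Hypothesis filtF : filtration N F.
Hypothesis siX : stationary_independent_increments P N F X.
Hypothesis N0 : (0 < N)%N.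
Hypothesis S00 : 0 < S0.
Hypothesis exp2 : (fun w => expR (X 1%N w)) \in Lfun P 2%:E.
Hypothesis exp_r1 : (fun w => expR (r1 * X 1%N w)) \in Lfun P 2%:E.
Hypothesis exp_r2 : (fun w => expR (r2 * X 1%N w)) \in Lfun P 2%:E.
Variables v g : nat -> R -> R.
Hypothesis mv : forall k, measurable_fun setT (v k).
Hypothesis mg : forall k, measurable_fun setT (g k).
Hypothesis v_le : forall k,
  exists2 c : R, 0 <= c & forall y, `|v k y| <= c * envelope r1 r2 y.
Hypothesis g_le : forall k,
  exists2 c : R, 0 <= c & forall y, `|g k y| <= c * envelope r1 r2 y.
Local Notation m1 := (mean_return P X).
Local Notation V := (var_return P X).
Hypothesis vS : forall k y,
  v k.+1 y = \int[P]_w v k (y + X 1%N w) - (m1 - 1) * g k y.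
Hypothesis g_regression : forall k y,
  V * g k y = \int[P]_w (expR (X 1%N w) * v k (y + X 1%N w)) -
              m1 * \int[P]_w v k (y + X 1%N w).

Local Notation TF n := (g_sigma_algebraType (F n)).
Local Notation inc := (increment X).
Local Notation stk := (stock X S0).
Local Notation ret := (X 1%N).

Definition log_stock n w : R := ln S0 + X n w.
Local Notation Y := log_stock.

Lemma stockE n w : stk n w = expR (Y n w).
Proof. by rewrite /stock /Y expRD lnK. Qed.

Definition payoff_value n w : R := v (N - n) (Y n w).
(** [g] is the amount of money held in the stock, [holding] the number of
    shares. *)
Definition holding n w : R := (stk n.-1 w)^-1 * g (N - n) (Y n.-1 w).
Definition hedge_error n w : R :=
  payoff_value n w - payoff_value 0%N w - gains holding stk n w.
Definition martingale_part n w : R :=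
  \sum_(1 <= k < n.+1) stk k.-1 w * (expR (inc k w) - m1).
Definition drift_part n w : R :=
  \sum_(1 <= k < n.+1) stk k.-1 w * (m1 - 1).
Local Notation H := payoff_value.
Local Notation hold := holding.
Local Notation L := hedge_error.
Local Notation M := martingale_part.
Local Notation A := drift_part.

(** Here y is the log price before the step and x the increment; k periods
    remain after it. *)
Definition step_error k (y x : R) : R :=
  v k (y + x) - v k.+1 y - g k y * (expR x - 1).

Let X0 w : X 0%N w = 0. Proof. by case: siX. Qed.

Let YS n w : Y n.+1 w = Y n w + inc n.+1 w.
Proof. by rewrite /Y /increment /=; ring. Qed.

Let dS n w : (0 < n)%N ->
  increment stk n w = expR (Y n.-1 w) * (expR (inc n w) - 1).
Proof.
case: n => // n _; rewrite /increment !stockE /= mulrBr mulr1 -expRD.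
by rewrite -YS.
Qed.

Let measY m n : (m <= n <= N)%N -> measurable_fun setT (Y m : TF n -> R).
Proof.
move=> mnN; apply: measurable_funD; first exact: measurable_cst.
exact: (measurable_X filtF siX).
Qed.

Let minc m n : (0 < m <= n)%N -> (n <= N)%N ->
  measurable_fun setT (inc m : TF n -> R).
Proof.
move=> /andP[m0 mn] nN; apply: measurable_funB;
  apply: (measurable_X filtF siX); rewrite nN andbT //.
exact: leq_trans (leq_pred m) mn.
Qed.

Let mS m n : (m <= n <= N)%N -> measurable_fun setT (stk m : TF n -> R).
Proof.
move=> mnN; rewrite (funext (stockE m)).
by apply: measurableT_comp => //; exact: measY.
Qed.

Let mret : measurable_fun setT ret.
Proof.
apply: (measurable_past filtF N0); apply: (measurable_X filtF siX).
by rewrite N0 leqnn.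
Qed.

Let env_ret : (fun w => envelope r1 r2 (ret w)) \in Lfun P 2%:E.
Proof. exact: Lfun2D. Qed.

Let env_Y n : (n <= N)%N -> (fun w => envelope r1 r2 (Y n w)) \in Lfun P 2%:E.
Proof.
move=> nN; have eX : (fun w => envelope r1 r2 (X n w)) \in Lfun P 2%:E.
  by apply: Lfun2D; exact: (Lfun2_expR filtF siX N0).
apply: envelope_shift => //.
apply: (measurable_past filtF nN); apply: (measurable_X filtF siX).
by rewrite nN leqnn.
Qed.

Let le_env_Lfun2 (u : R -> R) (W : T -> R) :
  measurable_fun setT u -> measurable_fun setT W ->
  (exists2 c : R, 0 <= c & forall y, `|u y| <= c * envelope r1 r2 y) ->
  (fun w => envelope r1 r2 (W w)) \in Lfun P 2%:E ->
  (fun w => u (W w)) \in Lfun P 2%:E.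
Proof.
move=> mu mW [c _ uc] eW; apply: (le_Lfun2 _ (Lfun2Z c eW)) => //.
exact: measurableT_comp.
Qed.

Let measYT n : (n <= N)%N -> measurable_fun setT (Y n).
Proof.
by move=> nN; apply: (measurable_past filtF nN); apply: measY; rewrite leqnn.
Qed.

Let H2 n : (n <= N)%N -> H n \in Lfun P 2%:E.
Proof.
move=> nN; apply: le_env_Lfun2; [exact: mv|exact: measYT|exact: v_le|].
exact: env_Y.
Qed.

Let S2 n : (n <= N)%N -> stk n \in Lfun P 2%:E.
Proof.
move=> nN; apply: Lfun2Z; under eq_fun do rewrite -[X _ _]mul1r.
apply: (Lfun2_expR filtF siX N0) => //.
by under eq_fun do rewrite mul1r.
Qed.

Let exp2B (c : R) : (fun w => expR (ret w) - c) \in Lfun P 2%:E.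
Proof. by apply: (Lfun2D exp2); exact: Lfun2_cst. Qed.

Let pred_le n : (0 < n <= N)%N -> (n.-1 <= N)%N.
Proof. by move=> /andP[_]; exact: leq_trans (leq_pred n). Qed.

(** The price cancels: the gain is a product of a function of the past and of a
    function of the increment, as [Lfun2_mul_increment] requires. *)
Let gainE n w : (0 < n)%N ->
  hold n w * increment stk n w = g (N - n) (Y n.-1 w) * (expR (inc n w) - 1).
Proof.
move=> n0; rewrite dS// /holding stockE; field.
by rewrite gt_eqF ?expR_gt0.
Qed.

Let mexpB (c : R) : measurable_fun setT (fun x : R => expR x - c).
Proof. by apply: measurable_funB => //; exact: measurable_cst. Qed.

Let gain2 n : (0 < n <= N)%N ->
  (fun w => hold n w * increment stk n w) \in Lfun P 2%:E.
Proof.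
move=> nN; have n0 : (0 < n)%N by case/andP: nN.
rewrite (funext (fun w => gainE w n0)).
apply: (@Lfun2_mul_increment _ _ _ _ _ _ _ filtF siX N0 n nN
  (fun w => g (N - n) (Y n.-1 w)) (fun x => expR x - 1)) => //.
- by apply: measurableT_comp => //; apply: measY; rewrite leqnn pred_le.
- apply: le_env_Lfun2; [exact: mg|exact/measYT/pred_le|exact: g_le|].
  exact/env_Y/pred_le.
Qed.

Let dM2 n : (0 < n <= N)%N ->
  (fun w => stk n.-1 w * (expR (inc n w) - m1)) \in Lfun P 2%:E.
Proof.
move=> nN.
apply: (@Lfun2_mul_increment _ _ _ _ _ _ _ filtF siX N0 n nN
  (stk n.-1) (fun x => expR x - m1)) => //.
- by apply: mS; rewrite leqnn pred_le.
- exact/S2/pred_le.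
Qed.

Let Lfun2_sum n (Z : nat -> T -> R) : (n <= N)%N ->
  (forall k, (0 < k <= N)%N -> Z k \in Lfun P 2%:E) ->
  (fun w => \sum_(1 <= k < n.+1) Z k w) \in Lfun P 2%:E.
Proof.
move=> + Z2; elim: n => [_|n IHn nN].
  by under eq_fun do rewrite big_geq//; exact: Lfun2_cst.
under eq_fun do rewrite big_nat_recr//=.
by apply: Lfun2D; [exact/IHn/ltnW|exact: Z2].
Qed.

Let measurable_bigsum n (Z : nat -> T -> R) :
  (forall k, (0 < k <= n)%N -> measurable_fun setT (Z k : TF n -> R)) ->
  measurable_fun setT ((fun w => \sum_(1 <= k < n.+1) Z k w) : TF n -> R).
Proof.
move=> mZ; suff h m : (m <= n)%N ->
    measurable_fun setT ((fun w => \sum_(1 <= k < m.+1) Z k w) : TF n -> R).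
  exact: h.
elim: m => [_|m IHm mn].
  by under eq_fun do rewrite big_geq//; exact: measurable_cst.
under eq_fun do rewrite big_nat_recr//=.
apply: measurable_funD; last exact: mZ.
by apply: IHm; exact: ltnW.
Qed.

Let M2 n : (n <= N)%N -> M n \in Lfun P 2%:E.
Proof.
move=> nN.
exact: (Lfun2_sum (Z := fun k w => stk k.-1 w * (expR (inc k w) - m1)) nN dM2).
Qed.

Let gains2 n : (n <= N)%N -> gains hold stk n \in Lfun P 2%:E.
Proof.
move=> nN.
exact: (Lfun2_sum (Z := fun k w => hold k w * increment stk k w) nN gain2).
Qed.

Let L2 n : (n <= N)%N -> L n \in Lfun P 2%:E.
Proof.
move=> nN; have H02 := H2 (leq0n N).
rewrite (_ : L n = fun w => H n w + (-1) * H 0%N w + (-1) * gains hold stk n w).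
  apply: Lfun2D; last by apply: Lfun2Z; exact: gains2.
  by apply: Lfun2D; [exact: H2|apply: Lfun2Z].
by apply/funext => w; rewrite !mulN1r.
Qed.

Let measH n m : (m <= n <= N)%N -> measurable_fun setT (H m : TF n -> R).
Proof. by move=> mnN; apply: measurableT_comp => //; exact: measY. Qed.

Let meas_holding n m : (0 < m <= n.+1)%N -> (n <= N)%N ->
  measurable_fun setT (hold m : TF n -> R).
Proof.
case: m => // m /andP[_ mn] nN.
have mY' : measurable_fun setT (Y m : TF n -> R).
  by apply: measY; rewrite -ltnS mn.
rewrite (_ : hold m.+1 = fun w => expR (- Y m w) * g (N - m.+1) (Y m w)).
  apply: measurable_funM; apply: measurableT_comp => //.
  exact: measurableT_comp.
by apply/funext => w; rewrite /holding stockE expRN.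
Qed.

Let meas_gains n m : (m <= n <= N)%N ->
  measurable_fun setT (gains hold stk m : TF n -> R).
Proof.
move=> /andP[mn nN].
have mgm : measurable_fun setT (gains hold stk m : TF m -> R).
  have mN := leq_trans mn nN.
  apply: measurable_bigsum => k /andP[k0 km]; apply: measurable_funM.
    by apply: meas_holding => //; rewrite k0 leqW.
  apply: measurable_funB; apply: mS; rewrite mN andbT //.
  exact: leq_trans (leq_pred k) km.
by apply: (measurable_future filtF _ mgm); rewrite mn.
Qed.

Let measL n m : (m <= n <= N)%N -> measurable_fun setT (L m : TF n -> R).
Proof.
move=> /[dup] mnN /andP[mn nN]; apply: measurable_funB.
  by apply: measurable_funB; apply: measH.
exact: meas_gains.
Qed.

Let measM n m : (m <= n <= N)%N -> measurable_fun setT (M m : TF n -> R).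
Proof.
move=> /andP[mn nN]; have mN := leq_trans mn nN.
have mMm : measurable_fun setT (M m : TF m -> R).
  apply: measurable_bigsum => k /andP[k0 km]; apply: measurable_funM.
    by apply: mS; rewrite mN andbT (leq_trans (leq_pred k) km).
  apply: (measurableT_comp (mexpB m1)).
  by apply: minc => //; rewrite k0.
by apply: (measurable_future filtF _ mMm); rewrite mn.
Qed.

Let integ (f : T -> R) := P.-integrable setT (EFin \o f).

Let integDZ (f h : T -> R) (c : R) : integ f -> integ h ->
  integ (fun w => f w + c * h w) /\
  \int[P]_w (f w + c * h w) = \int[P]_w f w + c * \int[P]_w h w.
Proof.
move=> iF ih; have ich : integ (fun w => c * h w).
  exact: (integrableZl measurableT c ih).
split; first exact: (integrableD measurableT iF ich).
by rewrite RintegralD// RintegralZl.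
Qed.

Let v_shift2 k y : (fun w => v k (y + ret w)) \in Lfun P 2%:E.
Proof.
apply: (le_env_Lfun2 (W := fun w => y + ret w)); [exact: mv| |exact: v_le|].
  exact: measurable_funD.
exact: envelope_shift.
Qed.

Lemma step_error_Lfun2 k y : (fun w => step_error k y (ret w)) \in Lfun P 2%:E.
Proof.
rewrite (_ : (fun w => _) = fun w => v k (y + ret w) + - v k.+1 y +
  (- g k y) * (expR (ret w) - 1)).
  by apply: Lfun2D; [apply: Lfun2D => //; exact: Lfun2_cst|exact: Lfun2Z].
by apply/funext => w; rewrite /step_error mulNr.
Qed.

Let int1 : \int[P]_w (1 : R) = 1.
Proof.
rewrite Rintegral_cst// mul1r; exact: (congr1 fine (probability_setT P)).
Qed.

Let i1 : integ (fun=> 1). Proof. exact/Lfun2_integrable/Lfun2_cst. Qed.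

Let iexp : integ (fun w => expR (ret w)). Proof. exact: Lfun2_integrable. Qed.

(** The recursion [vS] is the choice of intercept that centers the error. *)
Lemma integral_step_error k y : \int[P]_w step_error k y (ret w) = 0.
Proof.
have iv := Lfun2_integrable (v_shift2 k y).
have [j1 E1] := integDZ (g k y - v k.+1 y) iv i1.
have [j2 E2] := integDZ (- g k y) j1 iexp.
transitivity (\int[P]_w (v k (y + ret w) + (g k y - v k.+1 y) * 1
    + - g k y * expR (ret w))).
  by apply: eq_Rintegral => w _; rewrite /step_error; ring.
rewrite E2 E1 int1 -/m1 vS; ring.
Qed.

(** The normal equation of the regression: [g_regression] makes the error
    uncorrelated with the return. *)
Lemma integral_step_error_return k y :
  \int[P]_w (step_error k y (ret w) * (expR (ret w) - m1)) = 0.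
Proof.
have iv := Lfun2_integrable (v_shift2 k y).
have iev := Lfun2M_integrable exp2 (v_shift2 k y).
have iee : integ (fun w => expR (ret w) ^+ 2) by exact: Lfun2_integrable_sqr.
have [j1 E1] := integDZ (- m1) iev iv.
have [j2 E2] := integDZ (g k y - v k.+1 y + g k y * m1) j1 iexp.
have [j3 E3] := integDZ (- (g k y - v k.+1 y) * m1) j2 i1.
have [j4 E4] := integDZ (- g k y) j3 iee.
transitivity (\int[P]_w (expR (ret w) * v k (y + ret w) + - m1 * v k (y + ret w)
    + (g k y - v k.+1 y + g k y * m1) * expR (ret w)
    + (- (g k y - v k.+1 y) * m1) * 1 + - g k y * expR (ret w) ^+ 2)).
  by apply: eq_Rintegral => w _; rewrite /step_error; ring.
rewrite E4 E3 E2 E1 int1 -/m1.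
have := g_regression k y; rewrite /var_return => gV.
lra.
Qed.

Lemma integral_return : \int[P]_w (expR (ret w) - m1) = 0.
Proof.
have [_ E1] := integDZ (- m1) iexp i1.
transitivity (\int[P]_w (expR (ret w) + - m1 * 1)).
  by apply: eq_Rintegral => w _; rewrite mulr1.
by rewrite E1 int1 -/m1 mulr1 subrr.
Qed.

Lemma hedge_error_step n w : (0 < n <= N)%N ->
  L n w = L n.-1 w + step_error (N - n) (Y n.-1 w) (inc n w).
Proof.
case: n => // n /andP[_ nN].
rewrite /hedge_error /step_error /gains [in LHS]big_nat_recr//= gainE//.
rewrite /payoff_value YS subnSK//=; ring.
Qed.

Lemma martingale_part_step n w : (0 < n)%N ->
  M n w = M n.-1 w + stk n.-1 w * (expR (inc n w) - m1).
Proof. by case: n => // n _; rewrite /martingale_part big_nat_recr. Qed.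

Let measfst d' (T' : measurableType d') (u : T' -> R) : measurable_fun setT u ->
  measurable_fun setT (fun p : T' * R => u p.1).
Proof.
by move=> mu; exact: (measurableT_comp mu (@measurable_fst _ _ _ _)).
Qed.

Let meas_return n :
  measurable_fun setT (fun p : TF n * R => expR p.2 - m1).
Proof. exact: (measurableT_comp (mexpB m1) (@measurable_snd _ _ _ _)). Qed.

Let meas_step_error n k : (0 < n <= N)%N ->
  measurable_fun setT (fun p : TF n.-1 * R => step_error k (Y n.-1 p.1) p.2).
Proof.
move=> nN; have mYn : measurable_fun setT (Y n.-1 : TF n.-1 -> R).
  by apply: measY; rewrite leqnn pred_le.
have mY1 := measfst mYn.
apply: measurable_funB; first apply: measurable_funB.
- apply: measurableT_comp => //; exact: measurable_funD.
- exact: measurableT_comp.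
apply: measurable_funM; first exact: measurableT_comp.
exact: (measurableT_comp (mexpB 1) (@measurable_snd _ _ _ _)).
Qed.

Lemma martingale_martingale_part : martingale P N F M.
Proof.
apply: (martingale_centered filtF siX N0).
- by move=> n nN; apply: measM; rewrite leqnn.
- by move=> n nN; apply: Lfun2_Lfun1; exact: M2.
move=> n nN; exists (fun p => stk n.-1 p.1 * (expR p.2 - m1)); split.
- apply: measurable_funM => //; apply: measfst.
  by apply: mS; rewrite leqnn pred_le.
- by move=> w; apply: martingale_part_step; case/andP: nN.
- move=> w; exact: (integrableZl measurableT (stk n.-1 w)
    (Lfun2_integrable (exp2B m1))).
- move=> w /=; rewrite RintegralZl//; last exact: (Lfun2_integrable (exp2B m1)).
  by rewrite integral_return mulr0.
Qed.

Lemma martingale_hedge_error : martingale P N F L.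
Proof.
apply: (martingale_centered filtF siX N0).
- by move=> n nN; apply: measL; rewrite leqnn.
- by move=> n nN; apply: Lfun2_Lfun1; exact: L2.
move=> n nN; exists (fun p => step_error (N - n) (Y n.-1 p.1) p.2); split.
- exact: meas_step_error.
- by move=> w; exact: hedge_error_step.
- by move=> w; exact: (Lfun2_integrable (step_error_Lfun2 (N - n) (Y n.-1 w))).
- by move=> w /=; exact: (integral_step_error (N - n) (Y n.-1 w)).
Qed.

(** The increment of L M is M dL + L dM + dL dM with M and L taken before the
    step; the first two terms are centered because L and M are martingales, the
    last one because the step error is uncorrelated with the return. *)
Lemma hedge_error_orthogonal : Defs.orthogonal P N F L M.
Proof.
apply: (martingale_centered filtF siX N0).
- move=> n nN; apply: measurable_funM.
    by apply: measL; rewrite leqnn.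
  by apply: measM; rewrite leqnn.
- by move=> n nN; exact: (Lfun2_mul_Lfun1 (L2 nN) (M2 nN)).
move=> n nN; have n0 : (0 < n)%N by case/andP: nN.
pose e (p : TF n.-1 * R) := step_error (N - n) (Y n.-1 p.1) p.2.
exists (fun p => M n.-1 p.1 * e p + L n.-1 p.1 * stk n.-1 p.1 * (expR p.2 - m1)
  + stk n.-1 p.1 * (e p * (expR p.2 - m1))).
have ie w : integ (fun w' => e (w, ret w')).
  exact: (Lfun2_integrable (step_error_Lfun2 (N - n) (Y n.-1 w))).
have iret := Lfun2_integrable (exp2B m1).
have ier w : integ (fun w' => e (w, ret w') * (expR (ret w') - m1)).
  exact: (Lfun2M_integrable (step_error_Lfun2 (N - n) (Y n.-1 w)) (exp2B m1)).
have iMe w : integ (fun w' => M n.-1 w * e (w, ret w')).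
  exact: (integrableZl measurableT (M n.-1 w) (ie w)).
have sum2 w := integDZ (L n.-1 w * stk n.-1 w) (iMe w) iret.
have sum3 w := integDZ (stk n.-1 w) (sum2 w).1 (ier w).
have e0 w : \int[P]_w' e (w, ret w') = 0.
  exact: (integral_step_error (N - n) (Y n.-1 w)).
have er0 w : \int[P]_w' (e (w, ret w') * (expR (ret w') - m1)) = 0.
  exact: (integral_step_error_return (N - n) (Y n.-1 w)).
have le1 : (n.-1 <= n.-1 <= N)%N by rewrite leqnn pred_le.
split.
- apply: measurable_funD; first apply: measurable_funD.
  + apply: measurable_funM; first by apply: measfst; exact: measM.
    exact: meas_step_error.
  + apply: measurable_funM => //; apply: measurable_funM; apply: measfst.
      exact: measL.
    exact: mS.
  + apply: measurable_funM; first by apply: measfst; exact: mS.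
    by apply: measurable_funM => //; exact: meas_step_error.
- move=> w; rewrite hedge_error_step// martingale_part_step// /e /=; ring.
- by move=> w; exact: (sum3 w).1.
- move=> w; rewrite (sum3 w).2 (sum2 w).2 RintegralZl//; last exact: (ie w).
  by rewrite e0 integral_return er0 !mulr0 !addr0.
Qed.

Let sF n : (n <= N)%N -> sigma_algebra setT (F n).
Proof. by case: filtF => + _ _; exact. Qed.

Lemma doob_decomposition_stock : doob_decomposition P N F stk M A.
Proof.
split.
- exact: martingale_martingale_part.
- case=> // n /andP[_ nN]; have nN1 := ltnW nN.
  apply/(measurable_wrtP (sF nN1)).
  rewrite /drift_part (_ : (fun w => _) =
    fun w => \sum_(1 <= k < n.+1) stk k.-1 w * (m1 - 1) + stk n w * (m1 - 1)).
    apply: measurable_funD.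
      apply: measurable_bigsum => k /andP[k0 kn].
      apply: measurable_funM => //; apply: mS.
      by rewrite nN1 andbT (leq_trans (leq_pred k)).
    by apply: measurable_funM => //; apply: mS; rewrite leqnn.
  by apply/funext => w; rewrite big_nat_recr.
- by move=> w; rewrite /martingale_part big_geq.
- by move=> w; rewrite /drift_part big_geq.
elim=> [|n IHn] w nN.
  by rewrite /martingale_part /drift_part !big_geq// !addr0.
have MS := martingale_part_step w (ltn0Sn n).
have AS : A n.+1 w = A n w + stk n w * (m1 - 1).
  by rewrite /drift_part big_nat_recr.
have dSn := dS w (ltn0Sn n); rewrite /= -stockE in dSn.
have -> : stk n.+1 w = stk n w + increment stk n.+1 w.
  by rewrite /increment addrC subrK.
rewrite dSn AS MS {1}(IHn w (ltnW nN)) /=; ring.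
Qed.

(** Any solution (v, g) of the recursion that grows at most like the envelope
    gives a decomposition; the integrals over the strip provide one. *)
Lemma FS_decomposition_recursion (W : T -> R) : W \in Lfun P 2%:E ->
  (forall w, W w = H N w) -> FS_decomposition P N F stk W (H 0%N) hold L.
Proof.
move=> W2 WH; split => //.
- apply/(measurable_wrtP (sF (leq0n N))); exact: measH.
- split.
    case=> // n /andP[_ nN]; apply/(measurable_wrtP (sF (ltnW nN))).
    by apply: meas_holding; [rewrite /= leqnn|exact: ltnW].
  by move=> n /andP[_ nN]; exact: gains2.
- split.
  + by split; [exact: martingale_hedge_error|exact: L2].
  + by move=> w; rewrite /hedge_error /gains big_geq// subr0 subrr.
  + exists M, A; split; first exact: doob_decomposition_stock.
    exact: hedge_error_orthogonal.
- by move=> w; rewrite WH /hedge_error; ring.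
Qed.

End backward_recursion.

(** * The processes as integrals over the strip *)

Section strip_integrals.
Context (R : realType) d (T : measurableType d) (P : probability T R).
Context (N : nat) (X : nat -> T -> R) (S0 r1 r2 : R).
Context (Pi : complex_measure R[i] R) (f : R -> R).
Hypothesis S00 : 0 < S0.
Hypothesis mX : measurable_fun setT (X 1%N).
Hypothesis exp2 : (fun w => expR (X 1%N w)) \in Lfun P 2%:E.
Hypothesis env2 : (fun w => envelope r1 r2 (X 1%N w)) \in Lfun P 2%:E.
Hypothesis payoff : forall s, 0 < s ->
  (f s)%:C = cintegral Pi (strip r1 r2) (cpow s).

Local Notation D := (strip r1 r2).
Local Notation stk := (stock X S0).
Local Notation v := (value P X r1 r2 Pi).
Local Notation g := (hedge P X r1 r2 Pi).
Local Notation Hv := (payoff_value N X S0 v).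
Local Notation xiv := (holding N X S0 g).
Local Notation Lv := (hedge_error N X S0 v g).
Local Notation Y := (log_stock X S0).

Let mD : measurable D. Proof. exact: measurable_strip. Qed.

Let ln_stock n w : ln (stk n w) = Y n w.
Proof. by rewrite stockE// expRK. Qed.

Lemma cintegral_Hz n w :
  cintegrable Pi D (fun z => Hz P N X S0 z n w) /\
  (Hv n w)%:C = cintegral Pi D (fun z => Hz P N X S0 z n w).
Proof.
have E : (fun z => Hz P N X S0 z n w) =
    fun z => hz P X z ^+ (N - n) * cexp (z * (Y n w)%:C).
  by apply/funext => z; rewrite /Hz /cpow ln_stock.
rewrite E; split.
  by apply: transform_integrable; exact: cbounded_hzX.
by rewrite -/(transform r1 r2 Pi _ _) (valueE mX exp2 env2 payoff).
Qed.

Lemma cintegral_xiz n w :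
  cintegrable Pi D (fun z => xiz P N X S0 z n w) /\
  (xiv n w)%:C = cintegral Pi D (fun z => xiz P N X S0 z n w).
Proof.
have E : (fun z => xiz P N X S0 z n w) = fun z => ((stk n.-1 w)^-1)%:C *
    ((gz P X z * hz P X z ^+ (N - n)) * cexp (z * (Y n.-1 w)%:C)).
  apply/funext => z; rewrite /xiz /cpow ln_stock mulrBl mul1r cexpD.
  by rewrite -rmorphN cexp_real expRN -stockE// [RHS]mulrC mulrA.
have ig := transform_integrable Pi (Y n.-1 w)
  (cbounded_gzhzX mX exp2 env2 (N - n)).
rewrite E; split; first exact: cintegrableZ.
rewrite cintegralZ// -/(transform r1 r2 Pi _ _).
by rewrite (hedgeE mX exp2 env2 payoff) -rmorphM.
Qed.

Let cintegral_gains n w :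
  let u z := \sum_(1 <= k < n.+1) xiz P N X S0 z k w * (increment stk k w)%:C in
  cintegrable Pi D u /\ (gains xiv stk n w)%:C = cintegral Pi D u.
Proof.
elim: n => [|n [IHi IHn]] /=.
  have -> : (fun z => \sum_(1 <= k < 1) xiz P N X S0 z k w *
      (increment stk k w)%:C) = fun=> 0 * 1.
    by apply/funext => z; rewrite big_geq// mul0r.
  have i1 := cbounded_integrable mD Pi (cbounded_cst D 1).
  split; first exact: cintegrableZ.
  by rewrite cintegralZ// mul0r /gains big_geq.
have [ix Ex] := cintegral_xiz n.+1 w.
have -> : (fun z => \sum_(1 <= k < n.+2) xiz P N X S0 z k w *
      (increment stk k w)%:C) = fun z =>
    (\sum_(1 <= k < n.+1) xiz P N X S0 z k w * (increment stk k w)%:C) +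
    (increment stk n.+1 w)%:C * xiz P N X S0 z n.+1 w.
  by apply/funext => z; rewrite big_nat_recr//= [X in _ + X]mulrC.
have iZ := cintegrableZ mD (increment stk n.+1 w)%:C ix.
split; first exact: cintegrableD.
rewrite cintegralD// cintegralZ// -IHn -Ex -rmorphM -rmorphD.
by rewrite /gains big_nat_recr//= [X in _ + X]mulrC.
Qed.

Lemma cintegral_Lz n w :
  cintegrable Pi D (fun z => Lz P N X S0 z n w) /\
  (Lv n w)%:C = cintegral Pi D (fun z => Lz P N X S0 z n w).
Proof.
have [in_ En] := cintegral_Hz n w.
have [i0 E0] := cintegral_Hz 0 w.
have [ig Eg] := cintegral_gains n w.
have -> : (fun z => Lz P N X S0 z n w) = fun z =>
    (Hz P N X S0 z n w + (-1) * Hz P N X S0 z 0 w) + (-1) *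
    \sum_(1 <= k < n.+1) xiz P N X S0 z k w * (increment stk k w)%:C.
  by apply/funext => z; rewrite !mulN1r.
have i0' := cintegrableZ mD (-1) i0.
have ig' := cintegrableZ mD (-1) ig.
have iH := cintegrableD mD in_ i0'.
split; first exact: cintegrableD.
rewrite cintegralD// cintegralD// !cintegralZ// -En -E0 -Eg.
by rewrite !mulN1r -!rmorphB.
Qed.

End strip_integrals.

(** * The decomposition *)

Lemma exp_moment_Lfun2 (R : realType) d (T : measurableType d)
    (P : probability T R) (X : nat -> T -> R) (a : R) :
  measurable_fun setT (X 1%N) -> exp_moment P X (2 * a) ->
  (fun w => expR (a * X 1%N w)) \in Lfun P 2%:E.
Proof.
move=> mX; rewrite /exp_moment unlock => ea; apply/Lfun2P; split.
  by apply: measurableT_comp => //; exact: measurable_funM.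
rewrite (eq_integral (fun w => (expR (2 * a * X 1%N w))%:E))// => w _.
by rewrite -expRM_natl mulrA.
Qed.

Unset Implicit Arguments.

Theorem proposition2p1 (R : realType) (d : measure_display)
  (T : measurableType d) (P : probability T R) (N : nat)
  (F : nat -> set (set T)) (X : nat -> T -> R) (S0 : R)
  (R1 R2 : R) (Pi : complex_measure R[i] R) (f : R -> R) :
  (0 < N)%N ->
  filtration N F ->
  stationary_independent_increments P N F X ->
  0 < S0 ->
  exp_moment P X 2 ->
  mgf P X 2 - mgf P X 1 ^+ 2 != 0 ->
  R1 <= R2 ->
  exp_moment P X (2 * R1) ->
  exp_moment P X (2 * R2) ->
  (forall s, 0 < s -> (f s)%:C = cintegral Pi (strip R1 R2) (cpow s)) ->
  square_integrable P (fun w => f (stock X S0 N w)) ->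
  exists H xi L : nat -> T -> R,
    [/\ FS_decomposition P N F (stock X S0)
          (fun w => f (stock X S0 N w)) (H 0%N) xi L,
        forall n w, (n <= N)%N ->
          cintegrable Pi (strip R1 R2) (fun z => Hz P N X S0 z n w) /\
          (H n w)%:C = cintegral Pi (strip R1 R2) (fun z => Hz P N X S0 z n w),
        forall n w, (0 < n <= N)%N ->
          cintegrable Pi (strip R1 R2) (fun z => xiz P N X S0 z n w) /\
          (xi n w)%:C =
            cintegral Pi (strip R1 R2) (fun z => xiz P N X S0 z n w),
        forall n w, (n <= N)%N ->
          cintegrable Pi (strip R1 R2) (fun z => Lz P N X S0 z n w) /\
          (L n w)%:C = cintegral Pi (strip R1 R2) (fun z => Lz P N X S0 z n w) &
        forall n w, (n <= N)%N ->
          L n w = H n w - H 0%N w - gains xi (stock X S0) n w].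
Proof.
move=> N0 filtF siX S00 em2 nondet _ em_r1 em_r2 payoff H2.
have mX : measurable_fun setT (X 1%N).
  apply: (measurable_past filtF N0); apply: (measurable_X filtF siX).
  by rewrite N0 leqnn.
have exp2 : (fun w => expR (X 1%N w)) \in Lfun P 2%:E.
  (* the moment hypothesis on 2 is the case a = 1 *)
  have := @exp_moment_Lfun2 _ _ _ P X 1 mX; rewrite mulr1 => /(_ em2).
  by under eq_fun do rewrite mul1r.
have e1 := exp_moment_Lfun2 mX em_r1.
have e2 := exp_moment_Lfun2 mX em_r2.
have env2 : (fun w => envelope R1 R2 (X 1%N w)) \in Lfun P 2%:E.
  exact: Lfun2D.
pose v := value P X R1 R2 Pi; pose g := hedge P X R1 R2 Pi.
exists (payoff_value N X S0 v), (holding N X S0 g), (hedge_error N X S0 v g).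
split.
- apply: (FS_decomposition_recursion filtF siX N0 S00 exp2 e1 e2).
  + exact: (measurable_value Pi mX exp2 env2).
  + exact: (measurable_hedge Pi mX exp2 env2).
  + exact: (value_le Pi mX exp2 env2).
  + exact: (hedge_le Pi mX exp2 env2).
  + exact: (valueS mX exp2 env2 payoff).
  + exact: (hedge_regression mX exp2 env2 nondet payoff).
  + exact: H2.
  + move=> w; rewrite /payoff_value subnn /v (value0 P X payoff).
    by rewrite -stockE.
- by move=> n w _; exact: (cintegral_Hz N S00 mX exp2 env2 payoff).
- by move=> n w _; exact: (cintegral_xiz N S00 mX exp2 env2 payoff).
- by move=> n w _; exact: (cintegral_Lz N S00 mX exp2 env2 payoff).
- by [].
Qed.
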